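(* Let $\mathcal{X}_1,\mathcal{X}_2\subset\mathbb{R}^d$ be compact convex sets and $c\in\mathcal{C}^2(\mathcal{X}_1\times\mathcal{X}_2)$. There is a constant $C>0$ that only depends on $\Vert c\Vert_{\mathcal{C}^2}$ such that, given two Wasserstein geodesics $(\mu_1^t)_{t\in[0,1]}$ in $\mathcal{P}(\mathcal{X}_1)$ and $(\mu_2^t)_{t\in[0,1]}$ in $\mathcal{P}(\mathcal{X}_2)$, the map $h:t\mapsto E(\mu_1^t,\mu_2^t)$ is differentiable on $[0,1]$ and its derivative satisfies, for all $s,t\in[0,1]$, $$|h'(t)-h'(s)|\leq C\,|t-s|\,\boldsymbol{W_2}(\boldsymbol{\mu}^0,\boldsymbol{\mu}^1)^2,$$ where $\boldsymbol{\mu}^t=(\mu_1^t,\mu_2^t)$. In particular, $E$ and $-E$ are displacement semi-convex.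
   Context: $\mathcal{P}(\mathcal{X}_i)$ is the set of Borel probability measures on $\mathcal{X}_i$. For a compact convex set $K\subset\mathbb{R}^m$, $\mathcal{C}^k(K)$ is the space of functions on $K$ admitting a $\mathcal{C}^k$ extension to $\mathbb{R}^m$, with norm $\Vert f\Vert_{\mathcal{C}^k}=\inf_{\tilde f}\sup_{|\alpha|\le k}\Vert\partial^\alpha\tilde f\Vert_\infty$ over such extensions $\tilde f$. Entropic optimal transport: $E(\mu_1,\mu_2)=\min_{\gamma\in\Pi(\mu_1,\mu_2)}\int c\,d\gamma+H(\gamma|\mu_1\otimes\mu_2)$, where $\Pi(\mu_1,\mu_2)$ is the set of probability measures on $\mathcal{X}_1\times\mathcal{X}_2$ with marginals $\mu_1,\mu_2$ and $H(\mu|\nu)=\int\log(d\mu/d\nu)\,d\mu$ if $\mu\ll\nu$ and $+\infty$ otherwise. $W_2(\mu,\nu)=\big(\min_{\gamma\in\Pi(\mu,\nu)}\int\Vert y-x\Vert^2d\gamma(x,y)\big)^{1/2}$ and $\boldsymbol{W_2}(\boldsymbol{\mu},\boldsymbol{\nu})=(W_2(\mu_1,\nu_1)^2+W_2(\mu_2,\nu_2)^2)^{1/2}$. A Wasserstein geodesic in $\mathcal{P}(\mathcal{X}_i)$ is a curve $\mu_i^t=((1-t)\pi^1+t\pi^2)_\#\gamma_i$, $t\in[0,1]$, where $\gamma_i$ is an optimal plan for $W_2(\mu_i^0,\mu_i^1)$ and $\pi^1,\pi^2$ are the projections of $\mathcal{X}_i\times\mathcal{X}_i$ on its factors. A functional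 $J$ on $\mathcal{P}(\mathcal{X}_1)\times\mathcal{P}(\mathcal{X}_2)$ is displacement semi-convex if there is $\lambda\in\mathbb{R}$ such that for all such pairs of geodesics and all $t\in[0,1]$, $J(\boldsymbol{\mu}^t)\le(1-t)J(\boldsymbol{\mu}^0)+tJ(\boldsymbol{\mu}^1)-\frac{\lambda}{2}t(1-t)\boldsymbol{W_2}(\boldsymbol{\mu}^0,\boldsymbol{\mu}^1)^2$. *)

(* Defs.v *)
From HB Require Import structures.
From mathcomp Require Import all_boot all_order all_algebra.
From mathcomp Require Import all_classical all_reals all_analysis.
Set Implicit Arguments.
Unset Strict Implicit.
Unset Printing Implicit Defensive.
Import Order.TTheory GRing.Theory Num.Theory.
Import numFieldNormedType.Exports.
Local Open Scope classical_set_scope.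
Local Open Scope ring_scope.

Section Ck.
Context {R : realType} {m : nat}.
Implicit Types (f g : 'rV[R]_m -> R) (K : set 'rV[R]_m) (k : nat).

Definition partial (i : 'I_m) f : 'rV[R]_m -> R :=
  fun x => 'D_(delta_mx 0 i) f x.

(* For functions of class C^{|a|} the order in which the partial derivatives
   are taken is irrelevant. *)
Definition partial_multi (a : 'I_m -> nat) f : 'rV[R]_m -> R :=
  foldr (fun i g => iter (a i) (partial i) g) f (enum 'I_m).

Fixpoint class_C k f : Prop :=
  continuous f /\
  if k is k'.+1 then
    forall i, (forall x, derivable f x (delta_mx 0 i)) /\
              class_C k' (partial i f)
  else True.

Definition Ck_extension k K f g : Prop :=
  class_C k g /\ forall x, K x -> g x = f x.

Definition Ck_on k K f : Prop := exists g, Ck_extension k K f g.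

Definition Ck_norm k K f : \bar R :=
  ereal_inf [set ereal_sup [set M | exists (a : 'I_m -> nat) (x : 'rV[R]_m),
                              (\sum_i a i <= k)%N /\
                              M = `|partial_multi a g x|%:E]
            | g in Ck_extension k K f].

End Ck.

Section EntropicOT.
Context {R : realType} {d : nat}.

Definition borel_rV := g_sigma_algebraType (@open 'rV[R]_d).

(* Borel probability measures on [X] are encoded as Borel probability measures
   on the whole space giving mass 1 to [X]; couplings of two such measures then
   automatically give mass 1 to the product set.  Since R^d is second
   countable, the product sigma-algebra on [borel_rV * borel_rV] is the Borel
   one. *)
Definition supported_in (X : set 'rV[R]_d) (mu : probability borel_rV R) : Prop :=
  mu X = 1%E.

Definition coupling (mu nu : probability borel_rV R)
    (g : probability (borel_rV * borel_rV)%type R) : Prop :=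
  forall A : set borel_rV, measurable A ->
    pushforward g fst A = mu A /\ pushforward g snd A = nu A.

Definition rel_entropy dT (T : measurableType dT) (mu nu : probability T R)
    : \bar R :=
  if `[< mu `<< nu >] then
    (\int[mu]_x lne (Radon_Nikodym (charge_of_finite_measure mu) nu x))%E
  else +oo%E.

Definition prod_set (X1 X2 : set 'rV[R]_d) : set 'rV[R]_(d + d) :=
  [set z | X1 (lsubmx z) /\ X2 (rsubmx z)].

(* The infimum is finite and attained for continuous [c] on compact sets. *)
Definition EOT (X1 X2 : set 'rV[R]_d) (c : 'rV[R]_(d + d) -> R)
    (mu1 mu2 : probability borel_rV R) : R :=
  fine (ereal_inf
    [set (\int[g]_(z in X1 `*` X2) (c (row_mx z.1 z.2))%:E
          + rel_entropy g (mu1 \x mu2))%E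
    | g in coupling mu1 mu2]).

(* The Euclidean norm; the library's norm on ['rV_d] is the sup norm. *)
Definition enorm (v : 'rV[R]_d) : R := Num.sqrt (\sum_i v 0 i ^+ 2).

Definition quad_cost (g : probability (borel_rV * borel_rV)%type R) : \bar R :=
  (\int[g]_z ((enorm ((z.2 : 'rV[R]_d) - z.1)) ^+ 2)%:E)%E.

Definition W2 (mu nu : probability borel_rV R) : R :=
  Num.sqrt (fine (ereal_inf [set quad_cost g | g in coupling mu nu])).

Definition W2pair (mu1 mu2 nu1 nu2 : probability borel_rV R) : R :=
  Num.sqrt (W2 mu1 nu1 ^+ 2 + W2 mu2 nu2 ^+ 2).

Definition optimal_plan (mu nu : probability borel_rV R)
    (g : probability (borel_rV * borel_rV)%type R) : Prop :=
  coupling mu nu g /\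
  forall g', coupling mu nu g' -> (quad_cost g <= quad_cost g')%E.

Definition interp (t : R) (z : borel_rV * borel_rV) : borel_rV :=
  (1 - t) *: (z.1 : 'rV[R]_d) + t *: (z.2 : 'rV[R]_d).

(* Only the values of the curve at times in [0, 1] are relevant. *)
Definition W2_geodesic (X : set 'rV[R]_d) (mu : R -> probability borel_rV R)
    : Prop :=
  (forall t : R, t \in `[0, 1] -> supported_in X (mu t)) /\
  exists g, optimal_plan (mu 0) (mu 1) g /\
    forall t : R, t \in `[0, 1] -> forall A : set borel_rV, measurable A ->
      mu t A = pushforward g (interp t) A.

Definition displacement_semiconvex (X1 X2 : set 'rV[R]_d)
    (J : probability borel_rV R -> probability borel_rV R -> R) : Prop :=
  exists lambda : R, forall mu1 mu2 : R -> probability borel_rV R,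
    W2_geodesic X1 mu1 -> W2_geodesic X2 mu2 ->
    forall t : R, t \in `[0, 1] ->
      J (mu1 t) (mu2 t) <=
        (1 - t) * J (mu1 0) (mu2 0) + t * J (mu1 1) (mu2 1)
        - lambda / 2 * t * (1 - t)
          * W2pair (mu1 0) (mu2 0) (mu1 1) (mu2 1) ^+ 2.

End EntropicOT.

Arguments borel_rV : clear implicits.

(* [h'] is the derivative of [h] on [0, 1], one-sided at the endpoints. *)
Definition derivative_on01 {R : realType} (h h' : R -> R) : Prop :=
  forall t : R, t \in `[0, 1] ->
    (h s - h t) / (s - t) @[s --> within `[0, 1] t^'] --> h' t.

(* Main.v *)
Require Import Defs.
From HB Require Import structures.
From mathcomp Require Import all_boot all_order all_algebra.
From mathcomp Require Import all_classical all_reals all_analysis.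
From mathcomp Require Import measurable_realfun ring lra.
Set Implicit Arguments.
Unset Strict Implicit.
Unset Printing Implicit Defensive.
Import Order.TTheory GRing.Theory Num.Theory.
Import numFieldNormedType.Exports.
Local Open Scope classical_set_scope.
Local Open Scope ring_scope.

(** Along two geodesics the marginals of the entropic problem move while its
    cost is fixed.  Let [gam1], [gam2] be the optimal plans that generate the
    geodesics.  A point of [gam_i] is a pair of endpoints and carries the
    particle which at time [t] sits at the interpolated position.  In these
    Lagrangian coordinates the marginals [gam1], [gam2] are fixed and only the
    cost [l_t] moves ([EOT_lagrangian]); so [h t] is the value of an entropic
    problem with fixed marginals, seen as a function of its cost.

    That value is an infimum of affine functions of the cost, with derivative
    the optimal plan.  Let [p_s] be the density of the optimal plan at time [s]
    with respect to the product of [gam1] and [gam2].  Using [p_s] as a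
    competitor at time [t] bounds [h t - h s] from above by
    [\int (l_t - l_s) p_s]; using the potentials at time [s] as competitors in
    the dual problem at time [t] bounds it from below by
    [\int (1 - expR (l_s - l_t)) p_s] ([dual_value_le], [dual_value_ge]).  The
    two bounds differ by a quadratic error in [l_t - l_s].  Taylor's formula for
    the cost ([C2_bounded_taylor]) turns this into
    [|h t - h s - (t - s) D s| <= K (t - s)^2], where [D s] averages the time
    derivative of the cost over [p_s] and [K] is a constant times the integral of
    the squared displacement against [p_s] ([EOT_geodesic_remainder]).  The
    squared displacement is the sum of a function of the first particle and one
    of the second, so its integral against any coupling of [gam1] and [gam2] is
    the squared Wasserstein distance.  An expansion of this form, uniform in [s]
    and [t], contains all the claims: [h] has derivative [D], [D] is Lipschitz
    with constant [2 K], and [h] differs from its chords by at most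
    [K t (1 - t)].

    Three ingredients support this.  The optimal plan has a density of the form
    [a b expR (- l)]: Sinkhorn's iteration for [a] and [b] contracts relative
    errors up to scalars, because the kernel [expR (- l)] is bounded above and
    below ([half_step_contraction], [schroedinger_system]).  The Gibbs variational
    principle shows that these [a] and [b] compute the infimum that defines the
    entropic cost ([rel_entropy_ge], [EOT_potentials]).  Finally, the constant may
    depend on the cost through its norm only, so that norm has to be finite: an
    extension is made bounded together with its derivatives by clamping the
    coordinates smoothly ([Ck_norm_lty]). *)

(** * Bounded measurable functions *)

Section BoundedMeasurable.
Context {dT} {T : measurableType dT} {R : realType}.
Implicit Types f g : T -> R.

Definition bounded_measurable f :=
  measurable_fun setT f /\ exists M : R, forall x, `|f x| <= M.

Lemma bounded_measurable_cst (r : R) : bounded_measurable (cst r).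
Proof. by split; [exact: measurable_cst|exists `|r|]. Qed.

Lemma bounded_measurableD f g : bounded_measurable f -> bounded_measurable g ->
  bounded_measurable (fun x => f x + g x).
Proof.
move=> [mf [M fM]] [mg [N gN]]; split; first exact: measurable_funD.
by exists (M + N) => x; apply: le_trans (ler_normD _ _) _; exact: lerD.
Qed.

Lemma bounded_measurableM f g : bounded_measurable f -> bounded_measurable g ->
  bounded_measurable (fun x => f x * g x).
Proof.
move=> [mf [M fM]] [mg [N gN]]; split; first exact: measurable_funM.
by exists (M * N) => x; rewrite normrM ler_pM.
Qed.

Lemma bounded_measurableN f : bounded_measurable f ->
  bounded_measurable (fun x => - f x).
Proof.
move=> [mf [M fM]]; split; first exact: measurableT_comp.
by exists M => x; rewrite normrN.
Qed.

Lemma bounded_measurableB f g : bounded_measurable f -> bounded_measurable g ->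
  bounded_measurable (fun x => f x - g x).
Proof.
by move=> bf bg; apply: bounded_measurableD => //; exact: bounded_measurableN.
Qed.

Lemma bounded_measurable_expR f : bounded_measurable f ->
  bounded_measurable (fun x => expR (f x)).
Proof.
move=> [mf [M fM]]; split; first exact: measurableT_comp.
exists (expR M) => x; rewrite gtr0_norm ?expR_gt0// ler_expR.
by rewrite (le_trans (ler_norm _)).
Qed.

Lemma bounded_measurable_integrable (P : probability T R) f :
  bounded_measurable f -> P.-integrable setT (EFin \o f).
Proof.
move=> [mf [M fM]]; apply: measurable_bounded_integrable => //.
  by rewrite ltey_eq fin_num_measure.
exists M; split; first exact: num_real.
by move=> x Mx y _ /=; rewrite (le_trans (fM _))// ltW.
Qed.

End BoundedMeasurable.

Lemma bounded_measurable_comp d1 d2 (T1 : measurableType d1)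
    (T2 : measurableType d2) (R : realType) (f : T2 -> R) (phi : T1 -> T2) :
  measurable_fun setT phi -> bounded_measurable f ->
  bounded_measurable (f \o phi).
Proof.
move=> mphi [mf [M fM]]; split; first exact: measurableT_comp.
by exists M => x /=.
Qed.

Section PositiveBounded.
Context {dT} {T : measurableType dT} {R : realType}.
Implicit Types f g : T -> R.

(** The class of all [expR u] with [u] bounded measurable: kernels, potentials
    in exponential form and densities live here, and it is stable under
    products and inverses, so that logarithms stay integrable throughout. *)
Definition log_bounded f :=
  (forall x, 0 < f x) /\ bounded_measurable (fun x => ln (f x)).

Lemma log_bounded_expR f : bounded_measurable f ->
  log_bounded (fun x => expR (f x)).
Proof.
move=> bf; split=> [x|]; first exact: expR_gt0.
by rewrite (_ : (fun _ => _) = f)//; apply/funext => x; rewrite expRK.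
Qed.

Lemma log_boundedE f : log_bounded f -> f = (fun x => expR (ln (f x))).
Proof. by move=> [f0 _]; apply/funext => x; rewrite lnK ?posrE. Qed.

Lemma log_bounded_bounded f : log_bounded f -> bounded_measurable f.
Proof.
move=> lf; rewrite (log_boundedE lf); apply: bounded_measurable_expR.
by case: lf.
Qed.

Lemma log_bounded_between f l u : measurable_fun setT f -> 0 < l ->
  (forall x, l <= f x <= u) -> log_bounded f.
Proof.
move=> mf l0 lfu.
have f0 x : 0 < f x by have /andP[+ _] := lfu x; exact: lt_le_trans.
split=> //; split; first by apply: measurableT_comp => //; exact: measurable_ln.
exists (`|ln l| + `|ln u|) => x; have /andP[lf fu] := lfu x.
have u0 : 0 < u by exact: lt_le_trans fu.
have h1 : ln l <= ln (f x) by rewrite ler_ln ?posrE.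
have h2 : ln (f x) <= ln u by rewrite ler_ln ?posrE.
rewrite ler_norml; apply/andP; split.
  rewrite lerNl (le_trans _ (_ : - ln l <= _))// ?lerN2//.
  by rewrite -[leLHS]addr0 lerD// -normrN ler_norm.
by rewrite (le_trans h2)// -[leLHS]add0r lerD// ler_norm.
Qed.

Lemma log_bounded_bounds f : log_bounded f ->
  exists l u : R, 0 < l /\ forall x, l <= f x <= u.
Proof.
move=> [f0 [_ [M fM]]]; exists (expR (- M)), (expR M); split.
  exact: expR_gt0.
move=> x; have := fM x; rewrite ler_norml => /andP[h1 h2].
by rewrite -[f x]lnK ?posrE// !ler_expR h1 h2.
Qed.

Lemma log_boundedM f g : log_bounded f -> log_bounded g ->
  log_bounded (fun x => f x * g x).
Proof.
move=> [f0 lf] [g0 lg]; split=> [x|]; first exact: mulr_gt0.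
rewrite (_ : (fun _ => _) = (fun x => ln (f x) + ln (g x))).
  exact: bounded_measurableD.
by apply/funext => x; rewrite lnM ?posrE.
Qed.

Lemma log_boundedV f : log_bounded f -> log_bounded (fun x => (f x)^-1).
Proof.
move=> [f0 lf]; split=> [x|]; first by rewrite invr_gt0.
rewrite (_ : (fun _ => _) = (fun x => - ln (f x))).
  exact: bounded_measurableN.
by apply/funext => x; rewrite lnV ?posrE.
Qed.

End PositiveBounded.

Lemma log_bounded_comp d1 d2 (T1 : measurableType d1)
    (T2 : measurableType d2) (R : realType) (f : T2 -> R) (phi : T1 -> T2) :
  measurable_fun setT phi -> log_bounded f -> log_bounded (f \o phi).
Proof.
by move=> mphi [f0 lf]; split => [x|]; [exact: f0|exact: bounded_measurable_comp lf].
Qed.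

Section RealIntegral.
Context {dT} {T : measurableType dT} {R : realType} (P : probability T R).
Implicit Types f g : T -> R.

Lemma Rintegral_prob_cst (r : R) : \int[P]_x r = r.
Proof.
transitivity (r * fine (P setT)); first exact: Rintegral_cst.
by rewrite probability_setT mulr1.
Qed.

Lemma EFin_Rintegral f : P.-integrable setT (EFin \o f) ->
  (\int[P]_x f x)%:E = (\int[P]_x (f x)%:E)%E.
Proof. by move=> intf; rewrite fineK// integrable_fin_num. Qed.

End RealIntegral.

Section Pushforward.
Context d1 d2 (X : measurableType d1) (Y : measurableType d2) (R : realType).
Variables (P : probability X R) (Q : probability Y R) (phi : X -> Y).
Hypothesis mphi : measurable_fun setT phi.
Hypothesis PQ : forall A, measurable A -> Q A = pushforward P phi A.

(** [Q] is only known to agree with the image of [P] on measurable sets, and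
    this is all an integral sees. *)
Lemma integral_law (f : Y -> R) : measurable_fun setT f ->
  P.-integrable setT (EFin \o (f \o phi)) ->
  (\int[Q]_y (f y)%:E = \int[P]_x (f (phi x))%:E)%E.
Proof.
move=> mf intf.
have mphi_mixin := isMeasurableFun.Build _ _ _ _ _ mphi.
pose mphi_pack : {mfun _ >-> _} := HB.pack phi mphi_mixin.
rewrite (eq_measure_integral (pushforward P mphi_pack)); last first.
  by move=> A mA _; exact: PQ.
by rewrite integral_pushforward//; exact/measurable_EFinP.
Qed.

Lemma Rintegral_law (f : Y -> R) : bounded_measurable f ->
  \int[Q]_y f y = \int[P]_x f (phi x).
Proof.
move=> bf; rewrite /Rintegral integral_law//; first by case: bf.
by apply: bounded_measurable_integrable; exact: bounded_measurable_comp bf.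
Qed.

End Pushforward.

(** * The Gibbs variational principle *)

(** This is [le_integral] for functions whose integrals may be infinite: the
    positive parts and the negative parts are compared separately. *)
Lemma le_integral_measurable dT (T : measurableType dT) (R : realType)
    (mu : {measure set T -> \bar R}) (f g : T -> \bar R) :
  measurable_fun setT f -> measurable_fun setT g ->
  (forall x, (f x <= g x)%E) -> (\int[mu]_x f x <= \int[mu]_x g x)%E.
Proof.
move=> mf mg fg; rewrite integralE [leRHS]integralE leeB//.
- apply: ge0_le_integral => //; [exact: measurable_funepos..|].
  by move=> x _; apply: (@funepos_le _ _ setT f g) => [y _|]; rewrite ?inE//.
- apply: ge0_le_integral => //; [exact: measurable_funeneg..|].
  by move=> x _; apply: (@funeneg_le _ _ setT f g) => [y _|]; rewrite ?inE//.
Qed.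

(** Concavity of the logarithm at the point [y / x]. *)
Lemma ln_ge_tangent (R : realType) (x y : R) : 0 < x -> 0 < y ->
  ln y + 1 - y / x <= ln x.
Proof.
move=> x0 y0.
have : ln (y / x) <= y / x - 1.
  by rewrite -ler_expR lnK ?posrE ?divr_gt0// -[leLHS](addrNK 1) addrC expR_ge1Dx.
rewrite ln_div ?posrE//; lra.
Qed.

Lemma measurable_lne_fin_num dT (T : measurableType dT) (R : realType)
    (f : T -> \bar R) : measurable_fun setT f ->
  (forall x, f x \is a fin_num) -> measurable_fun setT (fun x => lne (f x)).
Proof.
move=> mf ffin.
have mff : measurable_fun setT (fun x => fine (f x)).
  by apply: measurableT_comp mf => //; exact: fine_measurable.
rewrite (_ : (fun _ => _) =
    (fun x => if 0 < fine (f x) then (ln (fine (f x)))%:E else -oo%E)).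
  apply: measurable_fun_ifT => //.
    by apply: measurable_fun_ltr => //; exact: measurable_cst.
  apply/measurable_EFinP.
  by apply: measurableT_comp => //; exact: measurable_ln.
apply/funext => x; rewrite -{1}[f x]fineK//; case: ifPn => h.
  by rewrite lne_EFin.
by rewrite le0_lneNy// lee_fin leNgt.
Qed.

Section Gibbs.
Context dT (T : measurableType dT) (R : realType).
Variables (nu : probability T R) (p : T -> R).
Hypotheses (lp : log_bounded p) (p1 : (\int[nu]_x (p x)%:E = 1)%E).

(** The lower bound on relative entropy follows from the tangent inequality
    [ln p + 1 - p / f <= ln f] for the density [f], whose left side has
    integral at least [\int ln p]. *)
Lemma rel_entropy_ge (mu : probability T R) :
  ((\int[mu]_x ln (p x))%:E <= rel_entropy mu nu)%E.
Proof.
rewrite /rel_entropy; case: asboolP => [munu|_]; last exact: leey.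
pose f := Radon_Nikodym_SigmaFinite.f mu nu.
have f0 x : (0 <= f x)%E by exact: Radon_Nikodym_SigmaFinite.f_ge0.
have ffin x : f x \is a fin_num by exact: Radon_Nikodym_SigmaFinite.f_fin_num.
have mf : measurable_fun setT f.
  exact: (measurable_int _ (Radon_Nikodym_SigmaFinite.f_integrable munu)).
pose phi x := fine (f x).
have phi0 x : 0 <= phi x by rewrite /phi fine_ge0.
have mphi : measurable_fun setT phi.
  by apply: measurableT_comp mf => //; exact: fine_measurable.
have fphi x : f x = (phi x)%:E by rewrite /phi fineK.
have mpos : measurable_fun setT (fun x => 0 < phi x).
  by apply: measurable_fun_ltr => //; exact: measurable_cst.
have [mlnp bp] : bounded_measurable (fun x => ln (p x)) by case: lp.
have [mp _] := log_bounded_bounded lp.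
have p0 x : 0 < p x by case: lp.
(* [q] is [p / f], written with [expR] and [ln] to be visibly measurable. *)
pose q x : R := if 0 < phi x then p x * expR (- ln (phi x)) else 0.
have q0 x : 0 <= q x.
  by rewrite /q; case: ifPn => // _; rewrite mulr_ge0 ?expR_ge0// ltW.
have mq : measurable_fun setT q.
  apply: measurable_fun_ifT => //.
  apply: measurable_funM => //; apply: measurableT_comp => //.
  by apply: measurableT_comp => //; apply: measurableT_comp => //; exact: measurable_ln.
have qE x : 0 < phi x -> q x = p x / phi x.
  by move=> h; rewrite /q h -lnV ?posrE// lnK// posrE invr_gt0.
have qle1 : (\int[mu]_x (q x)%:E <= 1)%E.
  rewrite -(@Radon_Nikodym_SigmaFinite.change_of_variables _ _ _ mu nu munu)//.
  - rewrite -p1; apply: ge0_le_integral => //.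
    + by move=> x _; rewrite mule_ge0 ?lee_fin.
    + by apply: emeasurable_funM => //; exact/measurable_EFinP.
    + exact/measurable_EFinP.
    + move=> x _; rewrite -/(f x) fphi -EFinM lee_fin.
      have [h|h] := ltP 0 (phi x); first by rewrite qE// divfK// gt_eqF.
      by rewrite /q ltNge h/= mul0r ltW.
  - exact/measurable_EFinP.
have intq : mu.-integrable setT (EFin \o q).
  apply/integrableP; split; first exact/measurable_EFinP.
  under eq_integral do rewrite /= ger0_norm//.
  exact: le_lt_trans qle1 (ltry _).
pose g x := ln (p x) + (1 - q x).
(* [L] is [ln f], corrected on the [mu]-null set where [f] vanishes so that
   the tangent inequality holds everywhere. *)
pose L x := if 0 < phi x then ln (phi x) else g x.
have mg : measurable_fun setT g.
  by apply: measurable_funD => //; apply: measurable_funB.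
have gL x : g x <= L x.
  rewrite /L; case: ifPn => // h; rewrite /g qE// addrA.
  exact: ln_ge_tangent.
apply: (@le_trans _ _ (\int[mu]_x (g x)%:E)%E).
  have int1 : mu.-integrable setT (EFin \o cst (1 : R)).
    exact/bounded_measurable_integrable/bounded_measurable_cst.
  have intlnp : mu.-integrable setT (EFin \o (fun x => ln (p x))).
    by apply: bounded_measurable_integrable; case: lp.
  have int1q : mu.-integrable setT (EFin \o (fun x => 1 - q x)).
    exact: integrableB int1 intq.
  rewrite -EFin_Rintegral; last exact: integrableD intlnp int1q.
  rewrite lee_fin RintegralD// lerDl RintegralB//= Rintegral_prob_cst subr_ge0.
  by rewrite -lee_fin EFin_Rintegral.
apply: (@le_trans _ _ (\int[mu]_x (L x)%:E)%E).
  apply: le_integral_measurable.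
  - exact/measurable_EFinP.
  - apply/measurable_EFinP; apply: measurable_fun_ifT => //.
    by apply: measurableT_comp => //; exact: measurable_ln.
  - by move=> x; rewrite lee_fin.
rewrite le_eqVlt; apply/orP; left; apply/eqP.
have mlnef : measurable_fun setT (fun x => lne (f x)).
  exact: measurable_lne_fin_num.
pose rn := Radon_Nikodym (charge_of_finite_measure mu) nu.
have mrn : measurable_fun setT rn.
  by apply: measurable_int; exact: Radon_Nikodym_integrable.
have rnfin x : rn x \is a fin_num by exact: Radon_Nikodym_fin_num.
have mlnern : measurable_fun setT (fun x => lne (rn x)).
  exact: measurable_lne_fin_num.
transitivity (\int[mu]_x lne (f x))%E.
  apply: ae_eq_integral => //.
    apply/measurable_EFinP; apply: measurable_fun_ifT => //.
    by apply: measurableT_comp => //; exact: measurable_ln.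
  exists (f @^-1` [set 0%E]); split.
  - by rewrite -[X in measurable X]setTI; exact: mf.
  - transitivity (\int[nu]_(x in f @^-1` [set 0%E]) f x)%E.
      apply: Radon_Nikodym_SigmaFinite.f_integral => //.
      by rewrite -[X in measurable X]setTI; exact: mf.
    by apply: integral0_eq => x /= ->.
  - move=> x /= /not_implyP[_ h]; rewrite fphi; congr EFin; apply/eqP.
    rewrite eq_le phi0 andbT leNgt; apply/negP => h0; apply: h.
    by rewrite /L h0 fphi lne_EFin.
apply: ae_eq_integral => //.
apply: (@null_dominates_ae_eq _ _ _ _ mu nu) => //.
have [N [mN N0 sN]] := ae_eq_Radon_Nikodym_SigmaFinite munu measurableT.
exists N; split => // x /= h; apply: sN => /= h'; apply: h => _.
by rewrite /f h'.
Qed.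

Definition density_measure : set T -> \bar R :=
  fun A => (\int[nu]_(x in A) (p x)%:E)%E.

Let intp : nu.-integrable setT (EFin \o p).
Proof. exact/bounded_measurable_integrable/log_bounded_bounded. Qed.

Let density0 : density_measure set0 = 0%E.
Proof. by rewrite /density_measure integral_set0. Qed.

Let density_ge0 A : (0 <= density_measure A)%E.
Proof.
by apply: integral_ge0 => x _; rewrite lee_fin ltW//; case: lp => + _; exact.
Qed.

Let density_sigma_additive : semi_sigma_additive density_measure.
Proof.
apply: semi_sigma_additive_nng_induced.
  by apply/measurable_EFinP; case: (log_bounded_bounded lp).
by move=> x; rewrite lee_fin ltW//; case: lp => + _; exact.
Qed.

HB.instance Definition _ := isMeasure.Build _ _ _
  density_measure density0 density_ge0 density_sigma_additive.

HB.instance Definition _ :=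
  @Measure_isProbability.Build _ _ R density_measure p1.

(** Equality in the Gibbs principle is attained by the measure of density
    [p]. *)
Lemma exists_density_measure : exists mu : probability T R,
  (forall A, mu A = \int[nu]_(x in A) (p x)%:E)%E /\
  rel_entropy mu nu = (\int[mu]_x ln (p x))%:E.
Proof.
exists density_measure; split=> //.
pose mu : probability T R := density_measure.
have munu : mu `<< nu.
  apply/null_content_dominatesP => A mA nuA0.
  apply: null_set_integral => //; apply: measurable_funTS.
  exact: (measurable_int _ intp).
rewrite /rel_entropy asboolT//.
pose rn := Radon_Nikodym (charge_of_finite_measure mu) nu.
have : ae_eq nu setT rn (EFin \o p).
  apply: integral_ae_eq => //.
  - exact: Radon_Nikodym_integrable.
  - exact: (measurable_int _ intp).
  - by move=> A _ mA; rewrite -Radon_Nikodym_integral.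
move=> /(@null_dominates_ae_eq _ _ _ _ mu nu _ _ _ measurableT munu) rnp.
rewrite EFin_Rintegral; last first.
  by apply: bounded_measurable_integrable; case: lp.
apply: ae_eq_integral => //; last first.
- have [N [mN N0 sN]] := rnp.
  exists N; split => // x /= h; apply: sN => /= h'; apply: h => _.
  apply: (etrans (congr1 (@lne R) (h' I))).
  by apply: lne_EFin; case: lp.
- by apply/measurable_EFinP; case: lp => _ [].
have mrn : measurable_fun setT rn.
  by apply: measurable_int; exact: Radon_Nikodym_integrable.
have rnfin x : rn x \is a fin_num by exact: Radon_Nikodym_fin_num.
exact: measurable_lne_fin_num.
Qed.

End Gibbs.

(** * Integrals on a product of probability spaces *)

Section RealIntegralBounds.
Context {dT} {T : measurableType dT} {R : realType} (P : probability T R).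
Implicit Types f g : T -> R.

Lemma le_Rintegral_bounded f g : bounded_measurable f ->
  bounded_measurable g -> (forall x, f x <= g x) ->
  \int[P]_x f x <= \int[P]_x g x.
Proof.
by move=> bf bg fg; apply: le_Rintegral => //;
  exact: bounded_measurable_integrable.
Qed.

Lemma Rintegral_between f l u : bounded_measurable f ->
  (forall x, l <= f x <= u) -> l <= \int[P]_x f x <= u.
Proof.
move=> bf lfu; apply/andP; split.
  rewrite -[leLHS](Rintegral_prob_cst P).
  apply: le_Rintegral_bounded => // [|x]; last by case/andP: (lfu x).
  exact: bounded_measurable_cst.
rewrite -[leRHS](Rintegral_prob_cst P).
apply: le_Rintegral_bounded => // [|x]; last by case/andP: (lfu x).
exact: bounded_measurable_cst.
Qed.

Lemma RintegralZl_bounded f r : bounded_measurable f ->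
  \int[P]_x (r * f x) = r * \int[P]_x f x.
Proof.
by move=> bf; apply: RintegralZl => //; exact: bounded_measurable_integrable.
Qed.

Lemma RintegralB_bounded f g : bounded_measurable f -> bounded_measurable g ->
  \int[P]_x (f x - g x) = \int[P]_x f x - \int[P]_x g x.
Proof.
by move=> bf bg; apply: RintegralB => //; exact: bounded_measurable_integrable.
Qed.

Lemma RintegralD_bounded f g : bounded_measurable f -> bounded_measurable g ->
  \int[P]_x (f x + g x) = \int[P]_x f x + \int[P]_x g x.
Proof.
by move=> bf bg; apply: RintegralD => //; exact: bounded_measurable_integrable.
Qed.

End RealIntegralBounds.

Section Fubini.
Context d1 d2 (T1 : measurableType d1) (T2 : measurableType d2) (R : realType).
Variables (P1 : probability T1 R) (P2 : probability T2 R).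
Implicit Types F : T1 * T2 -> R.

Lemma bounded_measurable_slice F x : bounded_measurable F ->
  bounded_measurable (fun y => F (x, y)).
Proof. exact: bounded_measurable_comp (pair1_measurable x). Qed.

Lemma bounded_measurable_slice2 F y : bounded_measurable F ->
  bounded_measurable (fun x => F (x, y)).
Proof. exact: bounded_measurable_comp (pair2_measurable y). Qed.

(** Tonelli gives measurability for nonnegative integrands; a bounded one
    becomes nonnegative after adding a constant. *)
Lemma bounded_measurable_Rintegral F : bounded_measurable F ->
  bounded_measurable (fun x => \int[P2]_y F (x, y)).
Proof.
move=> bF; have [mF [M FM]] := bF; split; last first.
  exists M => x; rewrite ler_norml.
  apply: Rintegral_between => [|y]; first exact: bounded_measurable_slice.
  by rewrite -ler_norml.
have FM0 z : 0 <= F z + M.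
  by have := FM z; rewrite ler_norml => /andP[+ _]; rewrite -lerBlDr sub0r.
have mFM : measurable_fun setT (fun z => (F z + M)%:E).
  by apply/measurable_EFinP; apply: measurable_funD.
have mI : measurable_fun setT (fun x => \int[P2]_y (F (x, y) + M)).
  have := @measurable_fun_fubini_tonelli_F _ _ _ _ _ P2 _ mFM FM0.
  by apply: measurableT_comp; exact: fine_measurable.
rewrite (_ : (fun _ => _) = fun x => \int[P2]_y (F (x, y) + M) - M).
  exact: measurable_funB.
apply/funext => x; rewrite RintegralD_bounded ?Rintegral_prob_cst ?addrK//.
  exact: bounded_measurable_slice.
exact: bounded_measurable_cst.
Qed.

Lemma Rintegral_fubini1 F : bounded_measurable F ->
  \int[(P1 \x P2)%E]_z F z = \int[P1]_x \int[P2]_y F (x, y).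
Proof.
move=> bF; rewrite {1}/Rintegral.
rewrite -(integral12_prod_meas1 (@bounded_measurable_integrable _ _ _ _ _ bF)).
congr fine; apply: eq_integral => x _; rewrite /= EFin_Rintegral//.
by apply: bounded_measurable_integrable; exact: bounded_measurable_slice.
Qed.

Lemma Rintegral_fubini2 F : bounded_measurable F ->
  \int[(P1 \x P2)%E]_z F z = \int[P2]_y \int[P1]_x F (x, y).
Proof.
move=> bF; rewrite {1}/Rintegral.
rewrite -(integral21_prod_meas1 (@bounded_measurable_integrable _ _ _ _ _ bF)).
congr fine; apply: eq_integral => x _; rewrite /= EFin_Rintegral//.
by apply: bounded_measurable_integrable; exact: bounded_measurable_slice2.
Qed.

End Fubini.

Section MarginalIntegrals.
Context d1 d2 (T1 : measurableType d1) (T2 : measurableType d2) (R : realType).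
Variables (P1 : probability T1 R) (P2 : probability T2 R) (p : T1 * T2 -> R).
Hypothesis lp : log_bounded p.

Let bp : bounded_measurable p. Proof. exact: log_bounded_bounded. Qed.

Let p0 z : 0 <= p z. Proof. by rewrite ltW//; case: lp => + _; exact. Qed.

Let integral_slice1 x : (forall x, \int[P2]_y p (x, y) = 1) ->
  (\int[P2]_y (p (x, y))%:E = 1)%E.
Proof.
move=> p1; rewrite -EFin_Rintegral ?p1//.
by apply: bounded_measurable_integrable; exact: bounded_measurable_slice.
Qed.

Let integral_slice2 y : (forall y, \int[P1]_x p (x, y) = 1) ->
  (\int[P1]_x (p (x, y))%:E = 1)%E.
Proof.
move=> p1; rewrite -EFin_Rintegral ?p1//.
by apply: bounded_measurable_integrable; exact: bounded_measurable_slice2.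
Qed.

(** A density [p] whose partial integrals are all 1 describes a coupling of
    [P1] and [P2]: it integrates functions of one variable as the corresponding
    marginal does.  The main use is for squared distances, which are only
    integrable. *)
Lemma integrable_density_marginal1 (phi : T1 -> R) :
  (forall x, \int[P2]_y p (x, y) = 1) -> P1.-integrable setT (EFin \o phi) ->
  (P1 \x P2)%E.-integrable setT (EFin \o (fun z => p z * phi z.1)).
Proof.
move=> p1 iphi; have mphi : measurable_fun setT phi.
  by apply/measurable_EFinP; exact: measurable_int iphi.
apply/integrable12ltyP.
  apply/measurable_EFinP; apply: measurable_funM; first by case: bp.
  by apply: measurableT_comp mphi _.
have -> : (\int[P1]_x \int[P2]_y `|(EFin \o (fun z => (p z * phi z.1)%R)) (x, y)| =
    \int[P1]_x `|(phi x)%:E|)%E.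
  apply: eq_integral => x _ /=.
  under eq_integral do rewrite normrM ger0_norm// mulrC EFinM.
  rewrite ge0_integralZl ?integral_slice1 ?mule1//.
  - by case: (bounded_measurable_slice x bp) => + _ => /measurable_EFinP.
  - by move=> y _; rewrite lee_fin.
by case/integrableP : iphi.
Qed.

Lemma Rintegral_density_marginal1 (phi : T1 -> R) :
  (forall x, \int[P2]_y p (x, y) = 1) -> P1.-integrable setT (EFin \o phi) ->
  \int[(P1 \x P2)%E]_z (p z * phi z.1) = \int[P1]_x phi x.
Proof.
move=> p1 iphi; rewrite /Rintegral.
rewrite -(integral12_prod_meas1 (integrable_density_marginal1 p1 iphi)).
congr fine; apply: eq_integral => x _; rewrite /fubini_F /=.
under eq_integral do rewrite mulrC EFinM.
rewrite integralZl ?integral_slice1 ?mule1//.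
by apply: bounded_measurable_integrable; exact: bounded_measurable_slice.
Qed.

Lemma integrable_density_marginal2 (phi : T2 -> R) :
  (forall y, \int[P1]_x p (x, y) = 1) -> P2.-integrable setT (EFin \o phi) ->
  (P1 \x P2)%E.-integrable setT (EFin \o (fun z => p z * phi z.2)).
Proof.
move=> p1 iphi; have mphi : measurable_fun setT phi.
  by apply/measurable_EFinP; exact: measurable_int iphi.
apply/integrable21ltyP.
  apply/measurable_EFinP; apply: measurable_funM; first by case: bp.
  by apply: measurableT_comp mphi _.
have -> : (\int[P2]_y \int[P1]_x `|(EFin \o (fun z => (p z * phi z.2)%R)) (x, y)| =
    \int[P2]_y `|(phi y)%:E|)%E.
  apply: eq_integral => y _ /=.
  under eq_integral do rewrite normrM ger0_norm// mulrC EFinM.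
  rewrite ge0_integralZl ?integral_slice2 ?mule1//.
  - by case: (bounded_measurable_slice2 y bp) => + _ => /measurable_EFinP.
  - by move=> x _; rewrite lee_fin.
by case/integrableP : iphi.
Qed.

Lemma Rintegral_density_marginal2 (phi : T2 -> R) :
  (forall y, \int[P1]_x p (x, y) = 1) -> P2.-integrable setT (EFin \o phi) ->
  \int[(P1 \x P2)%E]_z (p z * phi z.2) = \int[P2]_y phi y.
Proof.
move=> p1 iphi; rewrite /Rintegral.
rewrite -(integral21_prod_meas1 (integrable_density_marginal2 p1 iphi)).
congr fine; apply: eq_integral => y _; rewrite /fubini_G /=.
under eq_integral do rewrite mulrC EFinM.
rewrite integralZl ?integral_slice2 ?mule1//.
by apply: bounded_measurable_integrable; exact: bounded_measurable_slice2.
Qed.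

Let bounded_measurable_indic d (T : measurableType d) (A : set T) :
  measurable A -> bounded_measurable (\1_A : T -> R).
Proof.
move=> mA; split=> //; exists 1 => x; rewrite indicE.
by case: (_ \in _); rewrite ?normr1 ?normr0.
Qed.

Lemma density_marginal1 A : measurable A -> (forall x, \int[P2]_y p (x, y) = 1) ->
  (\int[(P1 \x P2)%E]_(z in fst @^-1` A) (p z)%:E = P1 A)%E.
Proof.
move=> mA p1; rewrite integral_mkcond epatch_indic.
have iA := bounded_measurable_integrable P1 (bounded_measurable_indic mA).
transitivity (\int[(P1 \x P2)%E]_z (p z * \1_A z.1)%:E)%E.
  by apply: eq_integral => z _; rewrite /= EFinM.
rewrite -EFin_Rintegral; last exact: integrable_density_marginal1 p1 iA.
rewrite (Rintegral_density_marginal1 p1 iA).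
by rewrite /Rintegral integral_indic// setIT fineK// fin_num_measure.
Qed.

Lemma density_marginal2 A : measurable A -> (forall y, \int[P1]_x p (x, y) = 1) ->
  (\int[(P1 \x P2)%E]_(z in snd @^-1` A) (p z)%:E = P2 A)%E.
Proof.
move=> mA p1; rewrite integral_mkcond epatch_indic.
have iA := bounded_measurable_integrable P2 (bounded_measurable_indic mA).
transitivity (\int[(P1 \x P2)%E]_z (p z * \1_A z.2)%:E)%E.
  by apply: eq_integral => z _; rewrite /= EFinM.
rewrite -EFin_Rintegral; last exact: integrable_density_marginal2 p1 iA.
rewrite (Rintegral_density_marginal2 p1 iA).
by rewrite /Rintegral integral_indic// setIT fineK// fin_num_measure.
Qed.

End MarginalIntegrals.

(** * The Schroedinger system *)

Section GeometricSequence.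
Variables (R : realType) (theta : R).
Hypotheses (theta0 : 0 <= theta) (theta1 : theta < 1).

Lemma geometric_close_cvg (v : nat -> R) (l C : R) :
  (forall n, `|l - v n| <= C * theta ^+ n) -> v n @[n --> \oo] --> l.
Proof.
move=> h; apply/cvgrPdist_le => e e0.
have : geometric C theta n @[n --> \oo] --> 0.
  by apply: cvg_geometric; rewrite ger0_norm.
move=> /cvgrPdist_le /(_ _ e0) H; near=> n.
apply: le_trans (h n) _.
have : `|0 - geometric C theta n| <= e by near: n.
by rewrite sub0r normrN; apply: le_trans; rewrite /geometric/= ler_norm.
Unshelve. all: by end_near. Qed.

(** The limit is the supremum of the lower ends of the nested intervals
    centred at [v n] with radius [c / (1 - theta) * theta ^+ n]. *)
Lemma geometric_steps_limit (v : nat -> R) (c : R) : 0 <= c ->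
  (forall n, `|v n.+1 - v n| <= c * theta ^+ n) ->
  exists l, forall n, `|l - v n| <= c / (1 - theta) * theta ^+ n.
Proof.
move=> c0 h; pose C := c / (1 - theta).
have t10 : 0 < 1 - theta by rewrite subr_gt0.
have Cc : C * (1 - theta) = c by rewrite /C divfK// gt_eqF.
pose lo n := v n - C * theta ^+ n; pose up n := v n + C * theta ^+ n.
have lo_nd : nondecreasing_seq lo.
  apply/nondecreasing_seqP => n; rewrite /lo exprS.
  have := h n; rewrite -Cc ler_norml => /andP[+ _]; lra.
have up_ni : nonincreasing_seq up.
  apply/nonincreasing_seqP => n; rewrite /up exprS.
  have := h n; rewrite -Cc ler_norml => /andP[_]; lra.
have C0 n : 0 <= C * theta ^+ n.
  by rewrite mulr_ge0 ?exprn_ge0// divr_ge0// ltW.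
have lo_up n m : lo n <= up m.
  apply: le_trans (lo_nd _ _ (leq_maxl n m)) _.
  apply: le_trans (up_ni _ _ (leq_maxr n m)).
  by rewrite /lo /up; have := C0 (maxn n m); lra.
exists (sup (range lo)) => n; rewrite -/C ler_norml.
have supr : has_sup (range lo).
  split; first by exists (lo 0); exists 0%N.
  by exists (up 0) => _ [m _ <-].
have h1 : lo n <= sup (range lo) by apply: ub_le_sup; [case: supr|exists n].
have h2 : sup (range lo) <= up n.
  by apply: ge_sup; [case: supr|move=> _ [m _ <-]].
by move: h1 h2; rewrite /lo /up => h1 h2; apply/andP; split; lra.
Qed.

End GeometricSequence.

Section Proportional.
Context {T : Type} {R : realType}.
Implicit Types f g : T -> R.

(** Closeness of two positive functions as rays, in the spirit of Hilbert's
    projective metric: [f] and [g] agree up to a scalar and a relative error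
    [e]. *)
Definition nearly_proportional (e : R) f g :=
  exists2 r : R, 0 < r & forall x, r * g x <= f x <= r * (1 + e) * g x.

Lemma nearly_proportionalV (e : R) f g : 0 <= e ->
  (forall x, 0 < f x) -> (forall x, 0 < g x) -> nearly_proportional e f g ->
  nearly_proportional e (fun x => (f x)^-1) (fun x => (g x)^-1).
Proof.
move=> e0 f0 g0 [r r0 rfg].
have e1 : 0 < 1 + e by rewrite ltr_wpDr.
exists ((r * (1 + e))^-1); first by rewrite invr_gt0 mulr_gt0.
move=> x; have /andP[h1 h2] := rfg x; apply/andP; split.
  by rewrite -invfM lef_pV2 ?posrE ?mulr_gt0.
rewrite invfM -[_ / _ * _]mulrA mulVf ?gt_eqF// mulr1 -invfM.
by rewrite lef_pV2 ?posrE ?mulr_gt0.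
Qed.

End Proportional.

Section KernelOperator.
Context d1 d2 (T1 : measurableType d1) (T2 : measurableType d2) (R : realType).
Variables (P2 : probability T2 R) (K : T1 * T2 -> R) (k : R).
Hypotheses (k0 : 0 < k) (mK : measurable_fun setT K).
Hypothesis kK : forall z, k <= K z <= k^-1.
Implicit Types f g : T2 -> R.

(** One half-step of the Sinkhorn iteration. *)
Definition half_step f : T1 -> R := fun x => (\int[P2]_y (K (x, y) * f y))^-1.

Lemma kernel_log_bounded : log_bounded K.
Proof. exact: log_bounded_between mK k0 kK. Qed.

Lemma kernel_slice_log_bounded f x : log_bounded f ->
  log_bounded (fun y => K (x, y) * f y).
Proof.
move=> lf; apply: log_boundedM => //.
exact: log_bounded_comp (pair1_measurable x) kernel_log_bounded.
Qed.

Lemma kernel_slice_bounded f x : log_bounded f ->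
  bounded_measurable (fun y => K (x, y) * f y).
Proof. by move=> lf; exact/log_bounded_bounded/kernel_slice_log_bounded. Qed.

Lemma kernel_integral_log_bounded f : log_bounded f ->
  log_bounded (fun x => \int[P2]_y (K (x, y) * f y)).
Proof.
move=> lf.
have lKf : log_bounded (fun z => K z * f z.2).
  apply: log_boundedM; first exact: kernel_log_bounded.
  exact: log_bounded_comp measurable_snd lf.
have [l [u [l0 lu]]] := log_bounded_bounds lKf.
apply: (@log_bounded_between _ _ _ _ l u) => //.
  by have [] := bounded_measurable_Rintegral P2 (log_bounded_bounded lKf).
move=> x; apply: Rintegral_between => [|y]; last exact: (lu (x, y)).
exact: kernel_slice_bounded.
Qed.

Lemma half_step_log_bounded f : log_bounded f -> log_bounded (half_step f).
Proof. by move=> lf; exact/log_boundedV/kernel_integral_log_bounded. Qed.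

Lemma half_step_solves f : log_bounded f ->
  forall x, half_step f x * \int[P2]_y (K (x, y) * f y) = 1.
Proof.
move=> lf x; rewrite /half_step mulVf// gt_eqF//.
by case: (kernel_integral_log_bounded lf).
Qed.

Lemma half_step_antitone f g (s : R) : log_bounded f -> log_bounded g -> 0 < s ->
  (forall y, f y <= s * g y) -> forall x, half_step g x <= s * half_step f x.
Proof.
move=> lf lg s0 fg x; rewrite /half_step.
have If : 0 < \int[P2]_y (K (x, y) * f y).
  by case: (kernel_integral_log_bounded lf).
have Ig : 0 < \int[P2]_y (K (x, y) * g y).
  by case: (kernel_integral_log_bounded lg).
rewrite ler_pdivlMr// mulrC ler_pdivrMr//.
rewrite -RintegralZl_bounded; last exact: kernel_slice_bounded.
apply: le_Rintegral_bounded; first exact: kernel_slice_bounded.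
  apply: bounded_measurableM; first exact: bounded_measurable_cst.
  exact: kernel_slice_bounded.
move=> y; rewrite mulrCA ler_wpM2l//.
by have /andP[+ _] := kK (x, y); apply: le_trans; exact: ltW.
Qed.

(** A kernel bounded between [k] and [k^-1] mixes: the part of [f] above
    [r * g], and likewise the part below [r * (1 + e) * g], is spread almost
    uniformly, so a fraction [k ^+ 2] of the relative error disappears. *)
Lemma half_step_contraction (e : R) f g : 0 <= e ->
  log_bounded f -> log_bounded g -> nearly_proportional e f g ->
  nearly_proportional ((1 - k ^+ 2) * e) (half_step f) (half_step g).
Proof.
move=> e0 lf lg [r r0 rfg].
pose F := \int[P2]_y f y; pose G := \int[P2]_y g y.
have bf := log_bounded_bounded lf; have bg := log_bounded_bounded lg.
have G0 : 0 < G.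
  have [l [u [l0 lu]]] := log_bounded_bounds lg.
  by have /andP[+ _] := Rintegral_between P2 bg lu; exact: lt_le_trans.
have bZ h c : bounded_measurable h -> bounded_measurable (fun y : T2 => c * h y : R).
  by apply: bounded_measurableM; exact: bounded_measurable_cst.
have rGF : r * G <= F.
  rewrite -RintegralZl_bounded//; apply: le_Rintegral_bounded => //.
    exact: bZ.
  by move=> y; case/andP: (rfg y).
have FrG : F <= r * (1 + e) * G.
  rewrite -RintegralZl_bounded//; apply: le_Rintegral_bounded => //.
    exact: bZ.
  by move=> y; case/andP: (rfg y).
(* The average ratio of [f] to [g]; both bounds of the ratio move towards it. *)
pose rho := F / G.
have rhoG : rho * G = F by rewrite /rho divfK// gt_eqF.
have r_rho : r <= rho by rewrite /rho ler_pdivlMr.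
have rho_r : rho <= r * (1 + e) by rewrite /rho ler_pdivrMr.
have k2 : 0 <= k ^+ 2 by exact: sqr_ge0.
(* [k <= 1] is read off at a point of the product; without one there is
   nothing to prove, or [P2] would be a probability on an empty type. *)
have [[x0 _]|noT1] := pselect (exists x : T1, True); last first.
  by exists 1 => // x; case: noT1; exists x.
have [[y0 _]|noT2] := pselect (exists y : T2, True); last first.
  exfalso; move: G0; rewrite /G (_ : g = cst 0) ?Rintegral_prob_cst ?ltxx//.
  by apply/funext => y; case: noT2; exists y.
have k21 : k ^+ 2 <= 1.
  have /andP[h1 h2] := kK (x0, y0).
  by rewrite expr2 -ler_pdivlMr// div1r (le_trans h1).
clear x0 y0.
have lkf := kernel_integral_log_bounded lf.
have lkg := kernel_integral_log_bounded lg.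
pose Af x := \int[P2]_y (K (x, y) * f y).
pose Ag x := \int[P2]_y (K (x, y) * g y).
have AgG x : k * Ag x <= G.
  rewrite -RintegralZl_bounded; last exact: kernel_slice_bounded.
  apply: le_Rintegral_bounded => //; first exact/bZ/kernel_slice_bounded.
  move=> y; rewrite mulrA -[leRHS]mul1r ler_wpM2r//.
    by rewrite ltW//; case: lg => + _; exact.
  by rewrite mulrC -ler_pdivlMr// div1r; case/andP: (kK (x, y)).
have Ag0 x : 0 <= Ag x by rewrite ltW//; case: lkg => + _; exact.
have spread h x : bounded_measurable h -> (forall y, 0 <= h y) ->
    k * (\int[P2]_y h y) <= \int[P2]_y (K (x, y) * h y).
  move=> bh h0; rewrite -RintegralZl_bounded//.
  apply: le_Rintegral_bounded; first exact: bZ.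
    apply: bounded_measurableM => //.
    exact/(bounded_measurable_slice x)/log_bounded_bounded/kernel_log_bounded.
  by move=> y; rewrite ler_wpM2r//; case/andP: (kK (x, y)).
have lower x : (r + k ^+ 2 * (rho - r)) * Ag x <= Af x.
  have bh : bounded_measurable (fun y => f y - r * g y).
    by apply: bounded_measurableB => //; exact: bZ.
  have H : k * ((rho - r) * G) <= Af x - r * Ag x.
    rewrite -[r * Ag x]RintegralZl_bounded; last exact: kernel_slice_bounded.
    rewrite -RintegralB_bounded; [|exact: kernel_slice_bounded|
      exact/bZ/kernel_slice_bounded].
    rewrite mulrBl rhoG /F /G -RintegralZl_bounded// -RintegralB_bounded//;
      last exact: bZ.
    rewrite [leRHS](_ : _ = \int[P2]_y (K (x, y) * (f y - r * g y))).
      by apply: spread => // y; rewrite subr_ge0; case/andP: (rfg y).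
    by apply: eq_Rintegral => y _; rewrite mulrBr [in RHS]mulrCA.
  suff : k ^+ 2 * (rho - r) * Ag x <= k * ((rho - r) * G) by lra.
  have -> : k ^+ 2 * (rho - r) * Ag x = k * ((rho - r) * (k * Ag x)) by ring.
  by rewrite ler_pM2l// ler_wpM2l// subr_ge0.
have upper x : Af x <= (r * (1 + e) - k ^+ 2 * (r * (1 + e) - rho)) * Ag x.
  have bh : bounded_measurable (fun y => r * (1 + e) * g y - f y).
    by apply: bounded_measurableB => //; exact: bZ.
  have H : k * ((r * (1 + e) - rho) * G) <= r * (1 + e) * Ag x - Af x.
    rewrite -[r * (1 + e) * Ag x]RintegralZl_bounded; last exact: kernel_slice_bounded.
    rewrite -RintegralB_bounded; [|exact/bZ/kernel_slice_bounded|
      exact: kernel_slice_bounded].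
    rewrite mulrBl rhoG /F /G -RintegralZl_bounded// -RintegralB_bounded//;
      last exact: bZ.
    rewrite [leRHS](_ : _ = \int[P2]_y (K (x, y) * (r * (1 + e) * g y - f y))).
      by apply: spread => // y; rewrite subr_ge0; case/andP: (rfg y).
    by apply: eq_Rintegral => y _; rewrite mulrBr [in RHS]mulrCA.
  suff : k ^+ 2 * (r * (1 + e) - rho) * Ag x <= k * ((r * (1 + e) - rho) * G).
    by lra.
  have -> : k ^+ 2 * (r * (1 + e) - rho) * Ag x =
    k * ((r * (1 + e) - rho) * (k * Ag x)) by ring.
  by rewrite ler_pM2l// ler_wpM2l// subr_ge0.
apply: nearly_proportionalV.
- by rewrite mulr_ge0 ?subr_ge0.
- by case: lkf.
- by case: lkg.
exists (r + k ^+ 2 * (rho - r)).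
  by apply: lt_le_trans r0 _; rewrite lerDl mulr_ge0 ?subr_ge0.
move=> x; rewrite -/(Af x) -/(Ag x) lower/=.
apply: le_trans (upper x) _; rewrite ler_wpM2r//.
have : 0 <= k ^+ 2 * (rho - r) * ((1 - k ^+ 2) * e).
  by apply: mulr_ge0; apply: mulr_ge0; rewrite ?subr_ge0.
lra.
Qed.

End KernelOperator.

Lemma ln_close (R : realType) (x y d : R) : 0 < x -> 0 < y ->
  x <= expR d * y -> y <= expR d * x -> `|ln x - ln y| <= d.
Proof.
move=> x0 y0; rewrite -ler_ln ?posrE ?mulr_gt0 ?expR_gt0// => xy.
rewrite -ler_ln ?posrE ?mulr_gt0 ?expR_gt0// => yx.
move: xy yx; rewrite !lnM ?posrE ?expR_gt0// !expRK => xy yx.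
by rewrite ler_norml; apply/andP; split; lra.
Qed.

Section SchroedingerSystem.
Context d1 d2 (T1 : measurableType d1) (T2 : measurableType d2) (R : realType).
Variables (P1 : probability T1 R) (P2 : probability T2 R).
Variables (K : T1 * T2 -> R) (k : R).
Hypotheses (k0 : 0 < k) (k1 : k <= 1) (mK : measurable_fun setT K).
Hypothesis kK : forall z, k <= K z <= k^-1.
Implicit Types b : T2 -> R.

Let K' (z : T2 * T1) := K (z.2, z.1).

Let mK' : measurable_fun setT K'.
Proof. exact: measurableT_comp mK (@measurable_swap _ _ _ _). Qed.

Let kK' z : k <= K' z <= k^-1. Proof. exact: kK. Qed.

Let hs1 b : T1 -> R := half_step P2 K b.

Let step b : T2 -> R := half_step P1 K' (hs1 b).

Let step_log_bounded b : log_bounded b -> log_bounded (step b).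
Proof.
move=> lb; apply: (half_step_log_bounded _ k0 mK' kK').
exact: (half_step_log_bounded _ k0 mK kK).
Qed.

Let step_monotone b b' (s : R) : log_bounded b -> log_bounded b' -> 0 < s ->
  (forall y, b y <= s * b' y) -> forall y, step b y <= s * step b' y.
Proof.
move=> lb lb' s0 bb'.
have l1 := half_step_log_bounded P2 k0 mK kK lb.
have l2 := half_step_log_bounded P2 k0 mK kK lb'.
apply: (half_step_antitone P1 k0 mK' kK' l2 l1 s0).
exact: (half_step_antitone P2 k0 mK kK lb lb' s0).
Qed.

(** The total mass [\int \int (hs1 b) K b] is 1 both before and after the
    second half-step, so [step b] can neither dominate [b] nor be dominated
    by it: this fixes the scalar left free by projective contraction. *)
Let step_mass b : log_bounded b -> \int[P2]_y (b y * (step b y)^-1) = 1.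
Proof.
move=> lb; pose a := hs1 b.
have la : log_bounded a by exact: (half_step_log_bounded _ k0 mK kK).
pose F z := K z * (a z.1 * b z.2).
have bF : bounded_measurable F.
  apply: log_bounded_bounded; apply: log_boundedM.
    exact: (kernel_log_bounded k0 mK kK).
  apply: log_boundedM; first exact: log_bounded_comp measurable_fst la.
  exact: log_bounded_comp measurable_snd lb.
transitivity (\int[P2]_y \int[P1]_x F (x, y)).
  apply: eq_Rintegral => y _; rewrite /step /half_step invrK.
  rewrite -RintegralZl_bounded.
    by apply: eq_Rintegral => x _; rewrite /F /K' /a /=; ring.
  exact: (kernel_slice_bounded k0 mK' kK').
rewrite -Rintegral_fubini2// Rintegral_fubini1//.
transitivity (\int[P1]_x (1 : R)); last exact: Rintegral_prob_cst.
apply: eq_Rintegral => x _; rewrite -(half_step_solves P2 k0 mK kK lb x).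
rewrite -RintegralZl_bounded; last exact: (kernel_slice_bounded k0 mK kK).
by apply: eq_Rintegral => y _; rewrite /F /a /hs1/=; ring.
Qed.

Let theta : R := 1 - k ^+ 2.

Let theta0 : 0 <= theta.
Proof. by rewrite subr_ge0 expr_le1// ltW. Qed.

Let theta1 : theta < 1.
Proof. by rewrite ltrBlDr ltrDl exprn_gt0. Qed.

Let step_contraction (e : R) b b' : 0 <= e -> log_bounded b -> log_bounded b' ->
  nearly_proportional e b b' ->
  nearly_proportional (theta * e) (step b) (step b').
Proof.
move=> e0 lb lb' /(half_step_contraction P2 k0 mK kK e0 lb lb') H.
have l1 := half_step_log_bounded P2 k0 mK kK lb.
have l2 := half_step_log_bounded P2 k0 mK kK lb'.
have te0 : 0 <= theta * e by rewrite mulr_ge0.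
have [r r0 rP] := half_step_contraction P1 k0 mK' kK' te0 l1 l2 H.
exists r => // y; have /andP[-> h] /= := rP y.
apply: le_trans h _; rewrite ler_wpM2r//.
  by rewrite ltW//; case: (step_log_bounded lb') => + _; exact.
by rewrite ler_pM2l// lerD2l -[leRHS]mul1r ler_wpM2r// ltW.
Qed.

Let iterate n : T2 -> R := iter n step (cst 1).

Let iterate_log_bounded n : log_bounded (iterate n).
Proof.
elim: n => [|n ih]; last exact: step_log_bounded.
split=> [y|]; first exact: ltr01.
rewrite (_ : (fun _ => _) = cst 0); first exact: bounded_measurable_cst.
by apply/funext => y; exact: ln1.
Qed.

Let iterate_gt0 n y : 0 < iterate n y.
Proof. by case: (iterate_log_bounded n). Qed.

Let iterate_nearly_proportional : exists2 e : R, 0 <= e & forall n,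
  nearly_proportional (e * theta ^+ n) (iterate n.+1) (iterate n).
Proof.
have [l [u [l0 lu]]] := log_bounded_bounds (iterate_log_bounded 1).
exists (`|u / l - 1|); first exact: normr_ge0.
elim=> [|n ih].
  exists l => // y; have /andP[h1 h2] := lu y.
  rewrite /= mulr1 h1/=; apply: le_trans h2 _.
  rewrite expr0 !mulr1 mulrC -ler_pdivrMr//.
  by have := ler_norm (u / l - 1); lra.
rewrite exprS mulrCA; apply: (step_contraction (b := iterate n.+1)) ih => //.
by rewrite mulr_ge0 ?exprn_ge0.
Qed.

Let iterate_step : exists2 e : R, 0 <= e & forall n y,
  `|ln (iterate n.+1 y) - ln (iterate n y)| <= e * theta ^+ n.
Proof.
have [e e0 H] := iterate_nearly_proportional; exists e => // n y.
have [r r0 rP] := H n; set d := e * theta ^+ n in rP *.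
have d0 : 0 <= d by rewrite mulr_ge0 ?exprn_ge0.
(* [step_mass] pins the proportionality factor: [r <= 1 <= r * (1 + d)]. *)
have lq : log_bounded (fun y => iterate n y * (iterate n.+1 y)^-1).
  apply: log_boundedM => //; exact: log_boundedV.
have := Rintegral_between P2 (log_bounded_bounded lq) (l := (r * (1 + d))^-1)
  (u := r^-1).
have rd : 0 < r * (1 + d) by rewrite mulr_gt0// ltr_wpDr.
case/(_ _)/andP.
  move=> z; have /andP[h1 h2] := rP z; apply/andP; split.
    by rewrite ler_pdivlMr// mulrC ler_pdivrMr// mulrC.
  by rewrite ler_pdivrMr// mulrC ler_pdivlMr// mulrC.
rewrite step_mass// => h1 h2.
have {}h1 : 1 <= r * (1 + d) by rewrite -invf_le1.
have {}h2 : r <= 1 by rewrite -invf_ge1.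
have /andP[h3 h4] := rP y.
have dexp : 1 + d <= expR d by exact: expR_ge1Dx.
have up : iterate n.+1 y <= expR d * iterate n y.
  apply: le_trans h4 _; apply: ler_wpM2r; first exact: ltW.
  by apply: le_trans dexp; rewrite -[leRHS]mul1r ler_wpM2r// addr_ge0.
have lo : iterate n y <= expR d * iterate n.+1 y.
  have : iterate n y <= r * (1 + d) * iterate n y.
    by rewrite -[leLHS]mul1r ler_wpM2r// ltW.
  move=> /le_trans; apply; rewrite mulrAC mulrC.
  by apply: ler_pM => //; rewrite ?addr_ge0// mulr_ge0 ?(ltW (iterate_gt0 _ _)) ?(ltW r0).
exact: ln_close.
Qed.

(** Sinkhorn's iterates converge geometrically in the uniform norm of their
    logarithms, and [step] is nonexpansive there, so the limit is a fixed
    point. *)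
Lemma schroedinger_system : exists (a : T1 -> R) (b : T2 -> R),
  [/\ log_bounded a, log_bounded b,
      forall x, a x * \int[P2]_y (K (x, y) * b y) = 1 &
      forall y, b y * \int[P1]_x (K (x, y) * a x) = 1].
Proof.
have [e e0 H] := iterate_step.
have /choice [u uP] : forall y, exists l, forall n,
    `|l - ln (iterate n y)| <= e / (1 - theta) * theta ^+ n.
  move=> y; exact: (@geometric_steps_limit _ _ theta0 theta1
    (fun n => ln (iterate n y)) _ e0 (fun n => H n y)).
set C := e / (1 - theta) in uP.
have u_cvg y : ln (iterate n y) @[n --> \oo] --> u y.
  exact: (geometric_close_cvg theta0 theta1 (fun n => uP y n)).
have bu : bounded_measurable u.
  split.
    apply: (@measurable_fun_cvg _ _ _ _ (fun n y => ln (iterate n y))) => //.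
    by move=> n; case: (iterate_log_bounded n) => _ [].
  have [_ [_ [M HM]]] := iterate_log_bounded 0.
  exists (C + M) => y; have -> : u y = (u y - ln (iterate 0 y)) + ln (iterate 0 y).
    by rewrite addrNK.
  apply: le_trans (ler_normD _ _) _; apply: lerD; last exact: HM.
  by have := uP y 0%N; rewrite expr0 mulr1.
pose b y := expR (u y).
have lb : log_bounded b by exact: log_bounded_expR.
have lsb := step_log_bounded lb.
have fixb : step b = b.
  apply/funext => y; have sb0 : 0 < step b y by case: lsb.
  have near_b n : `|ln (step b y) - ln (iterate n.+1 y)| <= C * theta ^+ n.
    set d := C * theta ^+ n.
    have ub z : b z <= expR d * iterate n z.
      rewrite -[iterate n z]lnK ?posrE// -expRD ler_expR.
      by have := uP z n; rewrite -/d ler_norml => /andP[_]; lra.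
    have lb' z : iterate n z <= expR d * b z.
      rewrite -[iterate n z]lnK ?posrE// -expRD ler_expR.
      by have := uP z n; rewrite -/d ler_norml => /andP[+ _]; lra.
    have := step_monotone lb (iterate_log_bounded n) (expR_gt0 d) ub y.
    have := step_monotone (iterate_log_bounded n) lb (expR_gt0 d) lb' y.
    have sn0 : 0 < step (iterate n) y := iterate_gt0 n.+1 y.
    by move=> lo up; exact: (ln_close sb0 sn0 up lo).
  rewrite -[LHS]lnK ?posrE//; congr expR.
  have c1 := geometric_close_cvg theta0 theta1 near_b.
  have c2 : ln (iterate n.+1 y) @[n --> \oo] --> u y.
    by rewrite (cvg_shiftS (fun n => ln (iterate n y))).
  exact: (cvg_unique _ c1 c2).
exists (hs1 b), b; split=> //.
- exact: (half_step_log_bounded _ k0 mK kK).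
- exact: (half_step_solves _ k0 mK kK).
- move=> y; rewrite -{1}fixb; apply: (half_step_solves _ k0 mK' kK').
  exact: (half_step_log_bounded _ k0 mK kK).
Qed.

End SchroedingerSystem.

(** [ln a] and [ln b] are the dual potentials of the entropic problem with
    marginals [P1], [P2] and cost [l]. *)
Definition schroedinger_solution d1 d2 (T1 : measurableType d1)
    (T2 : measurableType d2) (R : realType) (P1 : probability T1 R)
    (P2 : probability T2 R) (l : T1 * T2 -> R) (a : T1 -> R) (b : T2 -> R) :=
  [/\ log_bounded a, log_bounded b,
      forall x, a x * \int[P2]_y (expR (- l (x, y)) * b y) = 1 &
      forall y, b y * \int[P1]_x (expR (- l (x, y)) * a x) = 1].

Definition gibbs_density {T1 T2 : Type} {R : realType} (l : T1 * T2 -> R)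
    (a : T1 -> R) (b : T2 -> R) (z : T1 * T2) : R :=
  expR (- l z) * (a z.1 * b z.2).

Definition dual_value d1 d2 (T1 : measurableType d1)
    (T2 : measurableType d2) (R : realType) (P1 : probability T1 R)
    (P2 : probability T2 R) (a : T1 -> R) (b : T2 -> R) : R :=
  \int[P1]_x ln (a x) + \int[P2]_y ln (b y).

Section SchroedingerSolution.
Context d1 d2 (T1 : measurableType d1) (T2 : measurableType d2) (R : realType).
Variables (P1 : probability T1 R) (P2 : probability T2 R) (l : T1 * T2 -> R).
Hypothesis bl : bounded_measurable l.

Lemma schroedinger_solution_exists :
  exists a b, schroedinger_solution P1 P2 l a b.
Proof.
have [ml [M lM]] := bl; pose k := expR (- `|M|).
have lM' z : - `|M| <= - l z <= `|M|.
  by rewrite -ler_norml normrN (le_trans (lM z))// ler_norm.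
apply: (@schroedinger_system _ _ _ _ _ P1 P2 (fun z => expR (- l z)) k).
- exact: expR_gt0.
- by rewrite -expR0 ler_expR oppr_le0.
- by do 2 apply: measurableT_comp => //.
- by move=> z; rewrite /k -expRN opprK !ler_expR.
Qed.

Variables (a : T1 -> R) (b : T2 -> R).
Hypothesis sol : schroedinger_solution P1 P2 l a b.
Let p := gibbs_density l a b.

Let la : log_bounded a. Proof. by case: sol. Qed.
Let lb : log_bounded b. Proof. by case: sol. Qed.

Lemma gibbs_density_log_bounded : log_bounded p.
Proof.
apply: log_boundedM; first exact/log_bounded_expR/bounded_measurableN.
apply: log_boundedM; first exact: log_bounded_comp measurable_fst la.
exact: log_bounded_comp measurable_snd lb.
Qed.

Let bK : bounded_measurable (fun z => expR (- l z)).
Proof. exact/bounded_measurable_expR/bounded_measurableN. Qed.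

Lemma gibbs_density_slice1 x : \int[P2]_y p (x, y) = 1.
Proof.
case: sol => _ _ s1 _; rewrite -(s1 x) -RintegralZl_bounded.
  by apply: eq_Rintegral => y _; rewrite /p /gibbs_density/=; ring.
apply: bounded_measurableM; last exact: log_bounded_bounded.
exact: (bounded_measurable_slice x bK).
Qed.

Lemma gibbs_density_slice2 y : \int[P1]_x p (x, y) = 1.
Proof.
case: sol => _ _ _ s2; rewrite -(s2 y) -RintegralZl_bounded.
  by apply: eq_Rintegral => x _; rewrite /p /gibbs_density/=; ring.
apply: bounded_measurableM; last exact: log_bounded_bounded.
exact: (bounded_measurable_slice2 y bK).
Qed.

Lemma ln_gibbs_density z : ln (p z) = ln (a z.1) + ln (b z.2) - l z.
Proof.
have a0 : 0 < a z.1 by case: la.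
have b0 : 0 < b z.2 by case: lb.
by rewrite /p !lnM ?posrE ?mulr_gt0 ?expR_gt0// expRK addrC.
Qed.

End SchroedingerSolution.

(** * Entropic transport cost from potentials *)

Lemma coupling_null_complement (R : realType) (d : nat)
    (X1 X2 : set (borel_rV R d)) (mu1 mu2 : probability (borel_rV R d) R)
    (gam : probability (borel_rV R d * borel_rV R d)%type R) :
  measurable X1 -> measurable X2 -> supported_in X1 mu1 -> supported_in X2 mu2 ->
  coupling mu1 mu2 gam -> gam (~` (X1 `*` X2)) = 0%E.
Proof.
move=> mX1 mX2 sX1 sX2 cgam.
have m1 : measurable (fst @^-1` X1 : set (borel_rV R d * borel_rV R d)).
  by rewrite -[X in measurable X]setTI; exact: measurable_fst.
have m2 : measurable (snd @^-1` X2 : set (borel_rV R d * borel_rV R d)).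
  by rewrite -[X in measurable X]setTI; exact: measurable_snd.
have out1 : gam (~` (fst @^-1` X1)) = 0%E.
  rewrite probability_setC//.
  have [h _] := cgam _ mX1; rewrite -[X in (_ - X)%E]/(pushforward gam fst X1).
  by rewrite h sX1 subee.
have out2 : gam (~` (snd @^-1` X2)) = 0%E.
  rewrite probability_setC//.
  have [_ h] := cgam _ mX2; rewrite -[X in (_ - X)%E]/(pushforward gam snd X2).
  by rewrite h sX2 subee.
apply/eqP; rewrite eq_le measure_ge0 andbT.
have -> : (~` (X1 `*` X2)) = ~` (fst @^-1` X1) `|` ~` (snd @^-1` X2).
  by rewrite -setCI.
apply: le_trans (measureU2 _ (measurableC m1) (measurableC m2)) _.
by rewrite [X in (X + _)%E]out1 [X in (_ + X)%E]out2 adde0.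
Qed.

Section EOTPotentials.
Context {R : realType} {d : nat}.
Notation V := (borel_rV R d).
Variables (X1 X2 : set 'rV[R]_d) (c g : 'rV[R]_(d + d) -> R).
Hypotheses (mX1 : measurable (X1 : set V)) (mX2 : measurable (X2 : set V)).
Hypothesis gc : forall z, prod_set X1 X2 z -> g z = c z.

Let cost (z : V * V) : R := g (row_mx z.1 z.2).
Hypothesis bcost : bounded_measurable cost.

Variables mu1 mu2 : probability V R.
Hypotheses (sX1 : supported_in X1 mu1) (sX2 : supported_in X2 mu2).

Lemma coupling_cost_integral (gam : probability (V * V)%type R) :
  coupling mu1 mu2 gam ->
  (\int[gam]_(z in X1 `*` X2) (c (row_mx z.1 z.2))%:E =
   (\int[gam]_z cost z)%:E)%E.
Proof.
move=> cgam.
have mD : measurable (X1 `*` X2 : set (V * V)) by exact: measurableX.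
transitivity (\int[gam]_(z in X1 `*` X2) (cost z)%:E)%E.
  apply: eq_integral => z; rewrite inE => -[z1 z2]; rewrite /cost gc//.
  by split; rewrite ?row_mxKl ?row_mxKr.
have out := coupling_null_complement mX1 mX2 sX1 sX2 cgam.
rewrite EFin_Rintegral; last exact: bounded_measurable_integrable.
pose N : set (V * V) := ~` (X1 `*` X2).
have mN : measurable N by exact: measurableC.
have intcost : gam.-integrable setT (EFin \o cost).
  exact: bounded_measurable_integrable.
rewrite [RHS](negligible_integral mN measurableT intcost out).
by rewrite /N setDE setCK setTI.
Qed.

Variables a b : V -> R.
Hypothesis sol : schroedinger_solution mu1 mu2 cost a b.

(** The Gibbs principle for the density [gibbs_density cost a b] makes the dual
    value a lower bound over all couplings, and the coupling that has this
    density attains it. *)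
Lemma EOT_potentials : EOT X1 X2 c mu1 mu2 = dual_value mu1 mu2 a b.
Proof.
have [la lb _ _] := sol.
pose p := gibbs_density cost a b.
have lp : log_bounded p := gibbs_density_log_bounded bcost sol.
have p1 := gibbs_density_slice1 bcost sol.
have p2 := gibbs_density_slice2 bcost sol.
have pE : (\int[(mu1 \x mu2)%E]_z (p z)%:E = 1)%E.
  have := density_marginal1 mu1 lp measurableT p1.
  by rewrite preimage_setT probability_setT.
pose W := dual_value mu1 mu2 a b.
have key gam : coupling mu1 mu2 gam ->
    (\int[gam]_(z in X1 `*` X2) (c (row_mx z.1 z.2))%:E +
     (\int[gam]_z ln (p z))%:E = W%:E)%E.
  move=> cgam; rewrite coupling_cost_integral// -EFinD; congr EFin.
  have blna : bounded_measurable (fun x => ln (a x)) by case: la.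
  have blnb : bounded_measurable (fun x => ln (b x)) by case: lb.
  rewrite -RintegralD_bounded//; last by case: lp.
  have law1 A : measurable A -> mu1 A = pushforward gam fst A.
    by move=> mA; have [-> _] := cgam _ mA.
  have law2 A : measurable A -> mu2 A = pushforward gam snd A.
    by move=> mA; have [_ ->] := cgam _ mA.
  rewrite /W /dual_value (Rintegral_law measurable_fst law1 blna).
  rewrite (Rintegral_law measurable_snd law2 blnb).
  rewrite -RintegralD_bounded.
  - by apply: eq_Rintegral => z _; rewrite (ln_gibbs_density sol) addrC subrK.
  - exact: bounded_measurable_comp measurable_fst blna.
  - exact: bounded_measurable_comp measurable_snd blnb.
rewrite /EOT; set S := [set _ | _ in _].
suff -> : ereal_inf S = W%:E by [].
apply/eqP; rewrite eq_le; apply/andP; split; last first.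
  apply: le_ereal_inf_tmp => _ [gam cgam <-].
  by rewrite -(key _ cgam) leeD2l// (rel_entropy_ge lp pE).
have [gam [gamE entE]] := exists_density_measure lp pE.
have cgam : coupling mu1 mu2 gam.
  by move=> A mA; split; rewrite /pushforward gamE;
    [exact: density_marginal1|exact: density_marginal2].
by apply: ereal_inf_lbound; exists gam => //; rewrite entE key.
Qed.

End EOTPotentials.

(** * Dependence of the dual value on the cost *)

(** From [expR v * (1 - v) <= 1] one gets [expR v - 1 - v <= v * (expR v - 1)],
    and both signs of [v] are easy from there. *)
Lemma expR_le_quadratic (R : realType) (v N : R) : `|v| <= N ->
  expR v <= 1 + v + expR N * v ^+ 2.
Proof.
move=> vN.
have e0 : 0 < expR v by exact: expR_gt0.
have h1 : expR v * (1 - v) <= 1.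
  rewrite -[leRHS](mulfV (lt0r_neq0 e0)) -expRN ler_pM2l//.
  exact: expR_ge1Dx.
suff h2 : v * (expR v - 1) <= expR N * v ^+ 2 by lra.
have expN : expR v <= expR N by rewrite ler_expR (le_trans (ler_norm _)).
have N1 : 1 <= expR N by rewrite -expR0 ler_expR (le_trans _ vN).
have [v0|v0] := leP 0 v.
  rewrite expr2 mulrCA ler_wpM2l//.
  by apply: le_trans (_ : v * expR v <= _); [lra|rewrite mulrC ler_wpM2r].
have h3 : 1 + v <= expR v by exact: expR_ge1Dx.
apply: le_trans (_ : v ^+ 2 <= _); last by rewrite ler_peMl// sqr_ge0.
by rewrite expr2 ler_nM2l//; lra.
Qed.

Section CostVariation.
Context d1 d2 (T1 : measurableType d1) (T2 : measurableType d2) (R : realType).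
Variables (P1 : probability T1 R) (P2 : probability T2 R).
Notation P := (P1 \x P2)%E.

Section DualValue.
Variable l : T1 * T2 -> R.
Hypothesis bl : bounded_measurable l.
Variables (a : T1 -> R) (b : T2 -> R).
Hypothesis sol : schroedinger_solution P1 P2 l a b.
Let p := gibbs_density l a b.

Lemma Rintegral_gibbs_density_dual (a' : T1 -> R) (b' : T2 -> R) :
  log_bounded a' -> log_bounded b' ->
  \int[P]_z (p z * (ln (a' z.1) + ln (b' z.2))) = dual_value P1 P2 a' b'.
Proof.
move=> [_ ba'] [_ bb'].
have lp := gibbs_density_log_bounded bl sol.
have ia' := bounded_measurable_integrable P1 ba'.
have ib' := bounded_measurable_integrable P2 bb'.
have p1 := gibbs_density_slice1 bl sol.
have p2 := gibbs_density_slice2 bl sol.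
rewrite /dual_value -(Rintegral_density_marginal1 lp p1 ia').
rewrite -(Rintegral_density_marginal2 lp p2 ib') -RintegralD//.
- by apply: eq_Rintegral => z _; rewrite mulrDr.
- exact: (integrable_density_marginal1 lp p1 ia').
- exact: (integrable_density_marginal2 lp p2 ib').
Qed.

Lemma Rintegral_gibbs_density : \int[P]_z p z = 1.
Proof.
have lp := gibbs_density_log_bounded bl sol.
rewrite Rintegral_fubini1//; last exact: log_bounded_bounded.
under eq_Rintegral do rewrite (gibbs_density_slice1 bl sol).
exact: Rintegral_prob_cst.
Qed.

End DualValue.

Variables l l' : T1 * T2 -> R.
Hypotheses (bl : bounded_measurable l) (bl' : bounded_measurable l').
Variables (a a' : T1 -> R) (b b' : T2 -> R).
Hypothesis sol : schroedinger_solution P1 P2 l a b.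
Hypothesis sol' : schroedinger_solution P1 P2 l' a' b'.
Let p := gibbs_density l a b.
Let p' := gibbs_density l' a' b'.

Let lp : log_bounded p := gibbs_density_log_bounded bl sol.
Let lp' : log_bounded p' := gibbs_density_log_bounded bl' sol'.
Let bp : bounded_measurable p := log_bounded_bounded lp.
Let bp' : bounded_measurable p' := log_bounded_bounded lp'.
Let p_gt0 z : 0 < p z. Proof. by case: lp. Qed.
Let p'_gt0 z : 0 < p' z. Proof. by case: lp'. Qed.

Let la : log_bounded a. Proof. by case: sol. Qed.
Let lb : log_bounded b. Proof. by case: sol. Qed.
Let la' : log_bounded a'. Proof. by case: sol'. Qed.
Let lb' : log_bounded b'. Proof. by case: sol'. Qed.

Let bounded_potentials (u : T1 -> R) (v : T2 -> R) : log_bounded u ->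
  log_bounded v -> bounded_measurable (fun z : T1 * T2 => ln (u z.1) + ln (v z.2)).
Proof.
move=> [_ bu] [_ bv]; apply: bounded_measurableD.
  exact: bounded_measurable_comp measurable_fst bu.
exact: bounded_measurable_comp measurable_snd bv.
Qed.

Let blab := bounded_potentials la lb.
Let blab' := bounded_potentials la' lb'.

(** The pointwise form of the nonnegativity of relative entropy. *)
Let entropy_bound x y : 0 < x -> 0 < y -> x - y <= x * (ln x - ln y) :> R.
Proof.
move=> x0 y0; have := ln_ge_tangent x0 y0.
rewrite -(ler_pM2l x0) mulrBr mulrDr mulr1 mulrCA divff ?gt_eqF// mulr1.
lra.
Qed.

(** The plan [p] is a competitor in the problem with cost [l']: the defect is
    the relative entropy of [p] with respect to [p']. *)
Lemma dual_value_le :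
  dual_value P1 P2 a' b' <= dual_value P1 P2 a b + \int[P]_z (p z * (l' z - l z)).
Proof.
have bd : bounded_measurable (fun z => p z * (l' z - l z)).
  by apply: bounded_measurableM => //; exact: bounded_measurableB.
rewrite -(Rintegral_gibbs_density_dual bl sol la' lb') -/p.
rewrite -(Rintegral_gibbs_density_dual bl sol la lb) -/p.
rewrite -RintegralD_bounded//; last exact: bounded_measurableM.
rewrite -subr_ge0 -RintegralB_bounded; first last.
- exact: bounded_measurableM.
- by apply: bounded_measurableD => //; exact: bounded_measurableM.
have -> : 0 = \int[P]_z (p z - p' z).
  rewrite RintegralB_bounded// (Rintegral_gibbs_density bl sol).
  by rewrite (Rintegral_gibbs_density bl' sol') subrr.
apply: le_Rintegral_bounded.
- exact: bounded_measurableB.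
- apply: bounded_measurableB; last exact: bounded_measurableM.
  by apply: bounded_measurableD => //; exact: bounded_measurableM.
move=> z; apply: le_trans (entropy_bound (p_gt0 z) (p'_gt0 z)) _.
rewrite [ln (p z)](ln_gibbs_density sol) [ln (p' z)](ln_gibbs_density sol').
by rewrite le_eqVlt; apply/orP; left;
  apply/eqP; ring.
Qed.

(** The potentials of [l] are competitors in the dual problem with cost [l']:
    the defect is the relative entropy of [p'] with respect to the unnormalized
    density [q] that they define with [l']. *)
Lemma dual_value_ge :
  dual_value P1 P2 a b + \int[P]_z (p z * (1 - expR (l z - l' z))) <=
  dual_value P1 P2 a' b'.
Proof.
have be : bounded_measurable (fun z => expR (l z - l' z)).
  by apply: bounded_measurable_expR; exact: bounded_measurableB.
pose q z := p z * expR (l z - l' z).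
have bq : bounded_measurable q by exact: bounded_measurableM.
have q_gt0 z : 0 < q z by rewrite mulr_gt0 ?expR_gt0.
have -> : \int[P]_z (p z * (1 - expR (l z - l' z))) = \int[P]_z (p' z - q z).
  transitivity (\int[P]_z (p z - q z)).
    by apply: eq_Rintegral => z _; rewrite mulrBr mulr1.
  rewrite !RintegralB_bounded// (Rintegral_gibbs_density bl sol).
  by rewrite (Rintegral_gibbs_density bl' sol').
rewrite -(Rintegral_gibbs_density_dual bl' sol' la' lb') -/p'.
rewrite -(Rintegral_gibbs_density_dual bl' sol' la lb) -/p'.
rewrite addrC -lerBrDr -RintegralB_bounded; [|exact: bounded_measurableM..].
apply: le_Rintegral_bounded.
- exact: bounded_measurableB.
- by apply: bounded_measurableB; exact: bounded_measurableM.
move=> z; apply: le_trans (entropy_bound (p'_gt0 z) (q_gt0 z)) _.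
rewrite /q lnM ?posrE ?expR_gt0// expRK.
rewrite [ln (p z)](ln_gibbs_density sol) [ln (p' z)](ln_gibbs_density sol').
by rewrite le_eqVlt; apply/orP; left;
  apply/eqP; ring.
Qed.

Let sandwich (v v' i1 i2 t c1 c2 q : R) : v' <= v + i1 -> v + i2 <= v' ->
  i1 <= t + c1 * q -> t + - (c1 + c2) * q <= i2 -> 0 <= c2 * q ->
  `|v' - v - t| <= (c1 + c2) * q.
Proof. by move=> *; rewrite ler_norml; apply/andP; split; lra. Qed.

(** By [dual_value_le] and [dual_value_ge], the increment of the dual value is
    [\int p (l' - l)] up to a quadratic error in [l' - l], integrated against
    the plan [p] of the unperturbed problem.  The weight [q1 + q2] is separable,
    so its integral against [p] depends on the marginals alone. *)
Lemma dual_value_expansion (D : T1 * T2 -> R) (q1 : T1 -> R) (q2 : T2 -> R)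
    (A B L N tau : R) :
  measurable_fun setT D ->
  P1.-integrable setT (EFin \o q1) -> P2.-integrable setT (EFin \o q2) ->
  (forall z, `|D z| <= L * (1 + (q1 z.1 + q2 z.2))) ->
  (forall z, `|l z| <= N) -> (forall z, `|l' z| <= N) ->
  (forall z, `|l' z - l z - tau * D z| <= A * tau ^+ 2 * (q1 z.1 + q2 z.2)) ->
  (forall z, (l' z - l z) ^+ 2 <= B * tau ^+ 2 * (q1 z.1 + q2 z.2)) ->
  `|dual_value P1 P2 a' b' - dual_value P1 P2 a b - tau * \int[P]_z (p z * D z)|
    <= (A + expR (N + N) * B) * tau ^+ 2 * (\int[P1]_x q1 x + \int[P2]_y q2 y).
Proof.
move=> mD iq1 iq2 DL lN l'N expD sqD.
have p1 := gibbs_density_slice1 bl sol.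
have p2 := gibbs_density_slice2 bl sol.
pose q z := q1 z.1 + q2 z.2.
have mp : measurable_fun setT p by case: bp.
have ipq1 := integrable_density_marginal1 lp p1 iq1.
have ipq2 := integrable_density_marginal2 lp p2 iq2.
have ipq : P.-integrable setT (EFin \o (fun z => p z * q z)).
  have -> : EFin \o (fun z => p z * q z) =
      (EFin \o (fun z => p z * q1 z.1)) \+ (EFin \o (fun z => p z * q2 z.2)).
    by apply/funext => z /=; rewrite mulrDr EFinD.
  exact: integrableD.
have Ipq : \int[P]_z (p z * q z) = \int[P1]_x q1 x + \int[P2]_y q2 y.
  rewrite -(Rintegral_density_marginal1 lp p1 iq1).
  rewrite -(Rintegral_density_marginal2 lp p2 iq2) -RintegralD//.
  by apply: eq_Rintegral => z _; rewrite mulrDr.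
have ip : P.-integrable setT (EFin \o p) := bounded_measurable_integrable _ bp.
have iZ f (c : R) : P.-integrable setT (EFin \o f) ->
    P.-integrable setT (EFin \o (fun z => c * f z)).
  by move=> /(integrableZl measurableT c); apply: eq_integrable => // z _.
have iD' f g : P.-integrable setT (EFin \o f) ->
    P.-integrable setT (EFin \o g) ->
    P.-integrable setT (EFin \o (fun z => f z + g z)).
  by move=> i1 i2; have := integrableD measurableT i1 i2; apply: eq_integrable.
have ipD : P.-integrable setT (EFin \o (fun z => p z * D z)).
  apply: (@le_integrable _ _ _ _ _ measurableT _
    (EFin \o (fun z => L * (p z + p z * q z)))) => //.
  - by apply/measurable_EFinP; exact: measurable_funM.
  - move=> z _ /=; rewrite lee_fin normrM (gtr0_norm (p_gt0 z)).
    apply: le_trans (ler_norm _).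
    have -> : L * (p z + p z * q z) = p z * (L * (1 + q z)) by ring.
    by rewrite ler_wpM2l// ltW.
  - exact/iZ/iD'.
rewrite -Ipq -!RintegralZl//.
set c1 := A * tau ^+ 2; set c2 := expR (N + N) * B * tau ^+ 2.
have -> : (A + expR (N + N) * B) * tau ^+ 2 = c1 + c2 by rewrite /c1 /c2; ring.
have blz : bounded_measurable (fun z => p z * (l' z - l z)).
  by apply: bounded_measurableM => //; exact: bounded_measurableB.
have b1 : \int[P]_z (p z * (l' z - l z)) <=
    \int[P]_z (tau * (p z * D z) + c1 * (p z * q z)).
  apply: le_Rintegral => //.
  - exact: bounded_measurable_integrable.
  - by apply: iD'; exact: iZ.
  move=> z _; have := expD z; rewrite -/c1 -/(q z) ler_norml => /andP[_ h].
  rewrite -subr_ge0.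
  have -> : tau * (p z * D z) + c1 * (p z * q z) - p z * (l' z - l z) =
    p z * (c1 * q z - (l' z - l z - tau * D z)) by ring.
  by rewrite mulr_ge0 ?(ltW (p_gt0 z))// subr_ge0.
have be : bounded_measurable (fun z => p z * (1 - expR (l z - l' z))).
  apply: bounded_measurableM => //; apply: bounded_measurableB.
    exact: bounded_measurable_cst.
  by apply: bounded_measurable_expR; exact: bounded_measurableB.
have b2 : \int[P]_z (tau * (p z * D z) + - (c1 + c2) * (p z * q z)) <=
    \int[P]_z (p z * (1 - expR (l z - l' z))).
  apply: le_Rintegral => //.
  - by apply: iD'; exact: iZ.
  - exact: bounded_measurable_integrable.
  move=> z _; have := expD z; rewrite -/c1 -/(q z) ler_norml => /andP[h _].
  have llN : `|l z - l' z| <= N + N.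
    by apply: le_trans (ler_normB _ _) _; exact: lerD.
  have h2 := expR_le_quadratic llN.
  have h3 : expR (N + N) * (l z - l' z) ^+ 2 <= c2 * q z.
    rewrite /c2 -mulrA -[leRHS]mulrA ler_pM2l ?expR_gt0//.
    by rewrite -sqrrN opprB mulrA; exact: sqD.
  rewrite -subr_ge0.
  have -> : p z * (1 - expR (l z - l' z)) -
      (tau * (p z * D z) + - (c1 + c2) * (p z * q z)) =
    p z * (1 - expR (l z - l' z) - tau * D z + (c1 * q z + c2 * q z)) by ring.
  by rewrite mulr_ge0 ?(ltW (p_gt0 z))//; lra.
have Isum c : \int[P]_z (tau * (p z * D z) + c * (p z * q z)) =
    tau * \int[P]_z (p z * D z) + c * \int[P]_z (p z * q z).
  by rewrite RintegralD ?RintegralZl//; exact: iZ.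
have Ipq0 : 0 <= c2 * \int[P]_z (p z * q z).
  rewrite -RintegralZl//; apply: Rintegral_ge0 => z _.
  rewrite mulrCA mulr_ge0 ?(ltW (p_gt0 z))//.
  apply: le_trans (_ : 0 <= expR (N + N) * (l' z - l z) ^+ 2) _.
    by rewrite mulr_ge0 ?expR_ge0 ?sqr_ge0.
  by rewrite /c2 -mulrA -[leRHS]mulrA ler_pM2l ?expR_gt0// mulrA; exact: sqD.
rewrite !RintegralZl//; move: b1 b2; rewrite !Isum => b1 b2.
exact: (sandwich dual_value_le dual_value_ge b1 b2 Ipq0).
Qed.

End CostVariation.

(** * Taylor estimates from coordinate-wise derivatives *)

Section CoordinateTaylor.
Context {R : realType} {m : nat}.
Implicit Types (f : 'rV[R]_m -> R) (x w : 'rV[R]_m) (i j : 'I_m).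

Lemma is_derive_coordinate_line f i x (s : R) :
  (forall y, derivable f y (delta_mx 0 i)) ->
  is_derive s 1 (fun r : R => f (x + r *: delta_mx 0 i))
    (partial i f (x + s *: delta_mx 0 i)).
Proof.
move=> df; pose y := x + s *: delta_mx 0 i.
have E : (fun h : R => h^-1 *: (((fun r : R => f (x + r *: delta_mx 0 i)) \o shift s)
      (h *: (1 : R)) - f (x + s *: delta_mx 0 i))) =
    (fun h : R => h^-1 *: ((f \o shift y) (h *: delta_mx 0 i) - f y)).
  apply/funext => h /=; congr (_ *: (f _ - _)).
  by rewrite /y [h%:A]mulr1 scalerDl addrCA.
apply: DeriveDef; first by rewrite /derivable E; exact: df.
by rewrite /derive E.
Qed.

Lemma coordinate_mean_value f i x (s : R) :
  (forall y, derivable f y (delta_mx 0 i)) ->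
  exists2 theta : R, `|theta| <= 1 &
  f (x + s *: delta_mx 0 i) - f x =
  s * partial i f (x + (theta * s) *: delta_mx 0 i).
Proof.
move=> df; pose phi (r : R) := f (x + r *: delta_mx 0 i).
pose dphi (r : R) := partial i f (x + r *: delta_mx 0 i).
have D (r : R) : is_derive r 1 phi (dphi r) by exact: is_derive_coordinate_line.
have C (a b : R) : {within `[a, b], continuous phi}.
  apply: continuous_subspaceT => r; apply: differentiable_continuous.
  by apply/derivable1_diffP; case: (D r).
have phi0 : phi 0 = f x by rewrite /phi scale0r addr0.
rewrite -phi0 -/(phi s).
have [s0|s0|->] := ltgtP s 0; last first.
- by exists 0; rewrite ?normr0// subrr mul0r.
- have [c /itvP c0s E] := MVT s0 (fun r _ => D r) (C _ _).
  exists (c / s); last by rewrite divfK ?gt_eqF// E subr0 mulrC.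
  by rewrite ger0_norm ?divr_ge0 ?c0s ?(ltW s0)// ler_pdivrMr// mul1r c0s.
- have [c /itvP cs0 E] := MVT s0 (fun r _ => D r) (C _ _).
  exists (c / s); last first.
    rewrite divfK ?lt_eqF//; move: E; rewrite sub0r mulrN -/(dphi c) => E.
    by rewrite mulrC -[RHS]opprK -E opprB.
  by rewrite ger0_norm ?mulr_le0 ?invr_le0 ?cs0 ?(ltW s0)//
    ler_ndivrMr// mul1r cs0.
Qed.

(** [x + truncate_row n w] is the [n]-th vertex of the path from [x] to [x + w]
    that follows the coordinate axes in increasing order. *)
Definition truncate_row (n : nat) w : 'rV[R]_m :=
  \row_i (if (i < n)%N then w 0 i else 0).

Lemma truncate_row0 w : truncate_row 0 w = 0.
Proof. by apply/rowP => i; rewrite !mxE. Qed.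

Lemma truncate_row_full w : truncate_row m w = w.
Proof. by apply/rowP => i; rewrite !mxE ltn_ord. Qed.

Lemma truncate_rowS j w :
  truncate_row j.+1 w = truncate_row j w + w 0 j *: delta_mx 0 j.
Proof.
apply/rowP => i; rewrite !mxE eqxx /= ltnS.
have [/eqP ->|ij] := boolP (i == j); first by rewrite leqnn ltnn add0r mulr1.
by rewrite mulr0 addr0 leq_eqVlt val_eqE (negbTE ij).
Qed.

Definition l1norm w : R := \sum_i `|w 0 i|.

Lemma l1norm_ge0 w : 0 <= l1norm w.
Proof. by apply: sumr_ge0 => i _; exact: normr_ge0. Qed.

Lemma truncate_row_lipschitz f (N : R) (n : nat) x w : 0 <= N -> (n <= m)%N ->
  (forall i, (i < n)%N -> (forall y, derivable f y (delta_mx 0 i)) /\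
    forall y, `|partial i f y| <= N) ->
  `|f (x + truncate_row n w) - f x| <= N * l1norm w.
Proof.
move=> N0 nm dN.
suff : `|f (x + truncate_row n w) - f x| <=
    N * \sum_(i < m | (i < n)%N) `|w 0 i|.
  move=> /le_trans; apply; rewrite ler_wpM2l// /l1norm.
  rewrite [leRHS](bigID (fun i : 'I_m => (i < n)%N))/=.
  by rewrite lerDl; apply: sumr_ge0.
elim: n nm dN => [|n ih] nm dN.
  by rewrite truncate_row0 addr0 subrr normr0 big_pred0_eq mulr0.
pose j := Ordinal nm.
rewrite (bigD1 j)//= mulrDr [leRHS]addrC.
rewrite (eq_bigl (fun i : 'I_m => (i < n)%N)); last first.
  by move=> i; rewrite ltnS leq_eqVlt -(inj_eq val_inj)/=; case: ltngtP.
have -> : f (x + truncate_row n.+1 w) - f x =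
    (f (x + truncate_row n w) - f x) +
    (f (x + truncate_row n w + w 0 j *: delta_mx 0 j) - f (x + truncate_row n w)).
  by rewrite -[n.+1]/(j.+1) truncate_rowS addrA [RHS]addrC subrKA.
apply: le_trans (ler_normD _ _) _; apply: lerD.
  by apply: ih => [|i il]; [exact: ltnW|apply: dN; exact: ltnW].
have [df Nf] := dN j (ltnSn n).
have [theta _ ->] := coordinate_mean_value (x + truncate_row n w) (w 0 j) df.
by rewrite normrM mulrC ler_wpM2r.
Qed.

Lemma row_lipschitz f (N : R) x w : 0 <= N ->
  (forall i, (forall y, derivable f y (delta_mx 0 i)) /\
    forall y, `|partial i f y| <= N) ->
  `|f (x + w) - f x| <= N * l1norm w.
Proof.
move=> N0 dN; have := @truncate_row_lipschitz f N m x w N0 (leqnn m).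
by rewrite truncate_row_full; apply => i _; exact: dN.
Qed.

(** The segment from [x] to [x + w] is replaced by a path along the
    coordinate axes.  On its [j]-th edge only coordinates up to [j] have moved,
    so only the second derivatives [partial i (partial j f)] with [i <= j]
    occur: these are the ones among the multi-index derivatives. *)
Lemma row_taylor f (N : R) x w : 0 <= N ->
  (forall j y, derivable f y (delta_mx 0 j)) ->
  (forall i j, (i <= j)%N ->
    (forall y, derivable (partial j f) y (delta_mx 0 i)) /\
    forall y, `|partial i (partial j f) y| <= N) ->
  `|f (x + w) - f x - \sum_j w 0 j * partial j f x| <= N * l1norm w ^+ 2.
Proof.
move=> N0 df ddf.
have -> : f (x + w) - f x = \sum_(j < m)
    (f (x + truncate_row j.+1 w) - f (x + truncate_row j w)).
  rewrite -(big_mkord xpredT (fun k => f (x + truncate_row k.+1 w) -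
    f (x + truncate_row k w))) (telescope_sumr (fun k => f (x + truncate_row k w)))//.
  by rewrite truncate_row_full truncate_row0 addr0.
rewrite -sumrB; apply: le_trans (ler_norm_sum _ _ _) _.
rewrite expr2 mulrCA {1}/l1norm mulr_suml; apply: ler_sum => j _.
have [theta theta1 E] := coordinate_mean_value (x + truncate_row j w) (w 0 j) (df j).
rewrite truncate_rowS addrA E -mulrBr normrM ler_wpM2l//.
(* The intermediate point on edge [j] is itself a vertex of a coordinate path,
   with a shorter last step. *)
pose w' : 'rV[R]_m := \row_i (if i == j then theta * w 0 j else w 0 i).
have -> : x + truncate_row j w + (theta * w 0 j) *: delta_mx 0 j =
    x + truncate_row j.+1 w'.
  rewrite truncate_rowS addrA {2}/w' mxE eqxx; congr (x + _ + _).
  apply/rowP => i; rewrite !mxE; case: ifP => // ij.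
  by rewrite ifF//; apply/eqP => ije; rewrite ije ltnn in ij.
apply: le_trans (_ : N * l1norm w' <= _); last first.
  rewrite ler_wpM2l//; apply: ler_sum => i _; rewrite mxE.
  case: eqP => // ->; rewrite normrM -[leRHS]mul1r ler_wpM2r//.
by apply: truncate_row_lipschitz => // i il; exact: ddf.
Qed.

Lemma l1norm_sqr_le w : l1norm w ^+ 2 <= m%:R ^+ 2 * \sum_i w 0 i ^+ 2.
Proof.
set S := \sum_i _.
have S0 : 0 <= S by apply: sumr_ge0 => i _; exact: sqr_ge0.
have : l1norm w <= m%:R * Num.sqrt S.
  rewrite mulr_natl -[X in _ *+ X]card_ord -sumr_const; apply: ler_sum => i _.
  rewrite -sqrtr_sqr ler_wsqrtr// /S (bigD1 i)//= lerDl.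
  by apply: sumr_ge0 => k _; exact: sqr_ge0.
move=> h; rewrite -[S]sqr_sqrtr// -exprMn.
by rewrite ler_sqr ?nnegrE ?l1norm_ge0// mulr_ge0 ?sqrtr_ge0.
Qed.

End CoordinateTaylor.

(** * Bounded extensions *)

Section Clamp.
Variable R : realType.
Implicit Types (s : R -> R) (x u : R).

Let is_derive_shift u (f : R -> R) (v df : R) : is_derive (u + v) 1 f df ->
  is_derive u 1 (fun x => f (x + v)) df.
Proof.
move=> D; have D' : is_derive u 1 (fun x : R => x + v) 1.
  by apply: is_derive_eq; rewrite addr0.
by have := @is_derive1_comp _ f (fun x => x + v) u _ _ D D'; rewrite mulr1.
Qed.

Let is_derive_reflect u (f : R -> R) (v df : R) : is_derive (- u + v) 1 f df ->
  is_derive u 1 (fun x => f (- x + v)) (- df).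
Proof.
move=> D; have D' : is_derive u 1 (fun x : R => - x + v) (- 1).
  by apply: is_derive_eq; rewrite addr0.
by have := @is_derive1_comp _ f (fun x => - x + v) u _ _ D D'; rewrite mulrN1.
Qed.

(** At 0 the difference quotient is either that of [s], which tends to
    [s' 0 = 0], or 0. *)
Lemma is_derive_positive_part s (s' : R -> R) :
  (forall u, is_derive u 1 s (s' u)) -> s' 0 = 0 ->
  forall u, is_derive u 1 (fun x => s (Num.max x 0)) (s' (Num.max u 0)).
Proof.
move=> ds s'0 u; have [u0|u0|->] := ltgtP u 0.
- rewrite s'0.
  apply: (@near_eq_is_derive _ _ _ (cst (s 0))).
    near=> x; rewrite /cst max_r//; apply: ltW; near: x.
    exact: lt_nbhsl.
- apply: (@near_eq_is_derive _ _ _ s).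
  near=> x; rewrite max_l//; apply: ltW; near: x.
  by apply: (cvgr_gt u) => //; exact: cvg_id.
- rewrite s'0.
  have [ex dv] := ds 0; rewrite s'0 in dv.
  have : (fun h : R => h^-1 *: ((s \o shift 0) (h *: (1 : R)) - s 0)) @ 0^' --> 'D_1 s 0.
    exact: ex.
  rewrite dv.
  move=> /cvgrPdist_le H.
  suff C : (fun h : R => h^-1 *: (((fun x => s (Num.max x 0)) \o shift 0)
      (h *: (1 : R)) - s (Num.max 0 0))) @ 0^' --> 0.
    by apply: DeriveDef; [apply/cvg_ex; exists 0|exact: cvg_lim].
  apply/cvgrPdist_le => e e0; have {}H := H e e0.
  near=> h; have : `|0 - h^-1 *: ((s \o shift 0) (h *: (1 : R)) - s 0)| <= e.
    by near: h.
  rewrite /= !addr0 !sub0r !normrN maxxx ![h%:A]mulr1 => Hh.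
  have [h0|h0] := leP h 0; last exact: Hh.
  by rewrite subrr scaler0 normr0 ltW.
Unshelve. all: by end_near. Qed.

(** The identity continued, with second-order contact at the ends of
    [[-B, B]], by translates of the sine. *)
Lemma smooth_clamp (B : R) : 0 <= B -> exists t t1 t2 : R -> R,
  [/\ forall x, is_derive x 1 t (t1 x) /\ is_derive x 1 t1 (t2 x),
      continuous t2,
      forall x, `|x| <= B -> t x = x &
      forall x, [/\ `|t x| <= B + 5, `|t1 x| <= B + 5 & `|t2 x| <= B + 5]].
Proof.
move=> B0.
pose pos x := Num.max x 0.
pose r0 u := u - sin u; pose r1 u := 1 - cos u : R.
have d0 u : is_derive u 1 r0 (r1 u) by apply: is_deriveB.
have d1 u : is_derive u 1 r1 (sin u).
  by apply: is_derive_eq; ring.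
have r10 : r1 0 = 0 by rewrite /r1 cos0 subrr.
have D0 := is_derive_positive_part d0 r10.
have D1 := is_derive_positive_part d1 (@sin0 R).
pose t x := x - r0 (pos (x - B)) + r0 (pos (- x - B)).
pose t1 x := 1 - r1 (pos (x - B)) - r1 (pos (- x - B)).
pose t2 x := - sin (pos (x - B)) + sin (pos (- x - B)).
exists t, t1, t2; split.
- move=> x; split.
  + have h1 := is_derive_shift (D0 (x - B)).
    have h2 := is_derive_reflect (D0 (- x - B)).
    by apply: is_derive_eq; rewrite /t1; ring.
  + have h1 := is_derive_shift (D1 (x - B)).
    have h2 := is_derive_reflect (D1 (- x - B)).
    by apply: is_derive_eq; rewrite /t2; ring.
- have cpos f : continuous f -> continuous (fun x : R => sin (pos (f x)) : R).
    move=> cf x; apply: continuous_comp; last exact: continuous_sin.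
    by apply: (@continuous_max _ _ f (cst 0)); [exact: cf|exact: cvg_cst].
  have c1 : continuous (fun y : R => y - B).
    by move=> y; apply: cvgB; [exact: cvg_id|exact: cvg_cst].
  have c2 : continuous (fun y : R => - y - B).
    by move=> y; apply: cvgB; [apply: cvgN; exact: cvg_id|exact: cvg_cst].
  move=> x; apply: cvgD; last exact: cpos c2 x.
  by apply: cvgN; exact: cpos c1 x.
- move=> x; rewrite ler_norml => /andP[h1 h2].
  rewrite /t /pos !max_r; [|by lra..].
  by rewrite /r0 sin0; lra.
- move=> x; split.
  + have [xB|Bx] := leP x B; last first.
      rewrite /t /pos max_l ?[Num.max (- x - B) 0]max_r; [|lra..].
      rewrite /r0 sin0; have := sin_le1 (x - B); have := sin_geN1 (x - B).
      by move=> *; rewrite ler_norml; apply/andP; split; lra.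
    have [xB'|Bx'] := leP (- B) x; last first.
      rewrite /t /pos max_r ?[Num.max (- x - B) 0]max_l; [|lra..].
      rewrite /r0 sin0; have := sin_le1 (- x - B); have := sin_geN1 (- x - B).
      by move=> *; rewrite ler_norml; apply/andP; split; lra.
    rewrite /t /pos !max_r; [|by lra..].
    by rewrite /r0 sin0 ler_norml; apply/andP; split; lra.
  + rewrite /t1 /r1; have := cos_le1 (pos (x - B)).
    have := cos_geN1 (pos (x - B)); have := cos_le1 (pos (- x - B)).
    have := cos_geN1 (pos (- x - B)).
    by move=> *; rewrite ler_norml; apply/andP; split; lra.
  + rewrite /t2; have := sin_le1 (pos (x - B)).
    have := sin_geN1 (pos (x - B)); have := sin_le1 (pos (- x - B)).
    have := sin_geN1 (pos (- x - B)).
    by move=> *; rewrite ler_norml; apply/andP; split; lra.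
Qed.

End Clamp.

Section ClampedExtension.
Context {R : realType} {m : nat}.
Implicit Types (f g : 'rV[R]_m -> R) (x : 'rV[R]_m) (i j : 'I_m).

Lemma row_continuous (S : topologicalType) (T : S -> 'rV[R]_m) :
  (forall i, continuous (fun s => T s 0 i)) -> continuous T.
Proof.
move=> cT s A [P Ps PA].
have H : \forall s' \near s, forall i : 'I_m, P 0 i (T s' 0 i).
  by apply: filter_forall => i; apply: cT; exact: Ps.
by apply: filterS H => s' H; apply: PA => i j; rewrite ord1; exact: H.
Qed.

Lemma row_coord_le_norm x i : `|x 0 i| <= `|x|.
Proof.
rewrite [leRHS]/Num.Def.normr/= mx_normrE.
by apply/bigmax_geP; right; exists (0, i).
Qed.

Lemma continuous_bounded_box f (B : R) : continuous f ->
  exists M : R, forall x, (forall i, `|x 0 i| <= B) -> `|f x| <= M.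
Proof.
move=> cf.
have cbox : compact [set x : 'rV[R]_m | forall i, `[- B, B]%classic (x ord0 i)].
  by apply: (@rV_compact _ _ (fun=> `[- B, B]%classic)) => _; exact: segment_compact.
have /compact_bounded [M [_ HM]] : compact (f @` [set x : 'rV[R]_m |
    forall i, `[- B, B]%classic (x ord0 i)]).
  by apply: continuous_compact => //; exact: continuous_subspaceT.
exists (M + 1) => x xB; apply: HM; first by rewrite ltrDl.
by exists x => // i; rewrite /= in_itv/= -ler_norml.
Qed.

Section ClampedFunction.
Variables (C : R) (t t1 t2 : R -> R).
Hypotheses (dt : forall r : R, is_derive r 1 t (t1 r))
  (dt1 : forall r : R, is_derive r 1 t1 (t2 r)) (ct2 : continuous t2).
Hypothesis tC : forall r : R, [/\ `|t r| <= C, `|t1 r| <= C & `|t2 r| <= C].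

Let clamp x : 'rV[R]_m := \row_i t (x 0 i).

Let derive_continuous (f df : R -> R) :
  (forall r : R, is_derive r 1 f (df r)) -> continuous f.
Proof.
by move=> D r; apply: differentiable_continuous; apply/derivable1_diffP;
  case: (D r).
Qed.

Let coord_comp_continuous (f : R -> R) i : continuous f ->
  continuous (fun x : 'rV[R]_m => f (x 0 i)).
Proof.
by move=> cf x; apply: continuous_comp; [exact: coord_continuous|exact: cf].
Qed.

Let continuous_mul (f h : 'rV[R]_m -> R) : continuous f -> continuous h ->
  continuous (fun x => f x * h x).
Proof. by move=> cf ch x; exact: (cvgM (cf x) (ch x)). Qed.

Let continuous_add (f h : 'rV[R]_m -> R) : continuous f -> continuous h ->
  continuous (fun x => f x + h x).
Proof. by move=> cf ch x; exact: (cvgD (cf x) (ch x)). Qed.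

Let clamp_continuous : continuous clamp.
Proof.
apply: row_continuous => i.
rewrite (_ : (fun _ => _) = (fun x : 'rV[R]_m => t (x 0 i))); last first.
  by apply/funext => x; rewrite mxE.
by apply: coord_comp_continuous; exact: derive_continuous dt.
Qed.

Let clamp_bound x i : `|clamp x 0 i| <= C.
Proof. by rewrite mxE; case: (tC (x 0 i)). Qed.

Let is_derive_of_line f x i (D : R) :
  is_derive (0 : R) 1 (fun r : R => f (x + r *: delta_mx 0 i)) D ->
  is_derive x (delta_mx 0 i) f D.
Proof.
move=> [ex dv].
have E : (fun h : R => h^-1 *: ((f \o shift x) (h *: delta_mx 0 i) - f x)) =
    (fun h : R => h^-1 *: (((fun r : R => f (x + r *: delta_mx 0 i)) \o shift 0)
      (h *: (1 : R)) - f (x + 0 *: delta_mx 0 i))).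
  apply/funext => h /=.
  by rewrite addr0 [h%:A]mulr1 scale0r addr0; congr (_ *: (f _ - f _)); rewrite addrC.
by apply: DeriveDef; [rewrite /derivable E; exact: ex|rewrite /derive E].
Qed.

(** Moving along one axis changes one coordinate of [clamp x], so this is
    the chain rule in one variable. *)
Let is_derive_clamp f x i : (forall y, derivable f y (delta_mx 0 i)) ->
  is_derive x (delta_mx 0 i) (f \o clamp) (partial i f (clamp x) * t1 (x 0 i)).
Proof.
move=> df; apply: is_derive_of_line.
have E : (fun r : R => (f \o clamp) (x + r *: delta_mx 0 i)) =
    (fun s : R => f (clamp x + s *: delta_mx 0 i)) \o
    (fun r : R => t (r + x 0 i) - t (x 0 i)).
  apply/funext => r /=; congr f; apply/rowP => k; rewrite !mxE eqxx/=.
  have [->|ki] := eqVneq k i; first by rewrite !mulr1 addrCA subrr addr0 addrC.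
  by rewrite !mulr0 !addr0.
rewrite E; apply: is_derive1_comp.
  rewrite add0r subrr.
  have := is_derive_coordinate_line (clamp x) 0 df.
  by rewrite scale0r addr0.
have D : is_derive (0 : R) 1 (fun r : R => t (r + x 0 i)) (t1 (x 0 i) * 1).
  apply: (@is_derive1_comp _ t (fun r => r + x 0 i)).
    by rewrite add0r.
  by apply: is_derive_eq; rewrite addr0.
by apply: is_derive_eq; rewrite mulr1 subr0.
Qed.

Let is_derive_coord (f df : R -> R) x i j : (forall r : R, is_derive r 1 f (df r)) ->
  is_derive x (delta_mx 0 j) (fun y : 'rV[R]_m => f (y 0 i))
    (if i == j then df (x 0 i) else 0).
Proof.
move=> Df; apply: is_derive_of_line.
have [->|ij] := eqVneq i j; last first.
  rewrite (_ : (fun _ => _) = cst (f (x 0 i))); first exact: is_derive_cst.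
  by apply/funext => r; rewrite !mxE (negbTE ij) mulr0 addr0.
rewrite (_ : (fun _ => _) = (fun r : R => f (r + x 0 j))); last first.
  by apply/funext => r; rewrite !mxE !eqxx mulr1 addrC.
rewrite -[df _]mulr1; apply: (@is_derive1_comp _ f (fun r => r + x 0 j)).
  by rewrite add0r.
by apply: is_derive_eq; rewrite addr0.
Qed.

Let partial_clamp f i : (forall y, derivable f y (delta_mx 0 i)) ->
  partial i (f \o clamp) = (fun x => partial i f (clamp x) * t1 (x 0 i)).
Proof.
by move=> df; apply/funext => x; rewrite /partial; case: (is_derive_clamp x df).
Qed.

Variable g : 'rV[R]_m -> R.
Hypothesis Cg : class_C 2 g.

Let dg i y : derivable g y (delta_mx 0 i).
Proof. by case: Cg => _ /(_ i) []. Qed.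

Let ddg i j y : derivable (partial i g) y (delta_mx 0 j).
Proof. by case: Cg => _ /(_ i) [_ [_ /(_ j) []]]. Qed.

Let cg : continuous g. Proof. by case: Cg. Qed.

Let cdg i : continuous (partial i g).
Proof. by case: Cg => _ /(_ i) [_ []]. Qed.

Let cddg i j : continuous (partial j (partial i g)).
Proof. by case: Cg => _ /(_ i) [_ [_ /(_ j) [_ []]]]. Qed.

Let second i j x : R :=
  partial j (partial i g) (clamp x) * t1 (x 0 j) * t1 (x 0 i) +
  partial i g (clamp x) * (if i == j then t2 (x 0 i) else 0).

Let is_derive_second i j x : is_derive x (delta_mx 0 j)
  (fun x => partial i g (clamp x) * t1 (x 0 i)) (second i j x).
Proof.
have D1 := is_derive_clamp x (@ddg i j).
have D2 := is_derive_coord x i j dt1.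
apply: (is_derive_eq (is_deriveM D1 D2)).
by rewrite /second /= ![_ *: _]mulrC addrC [_ * t1 (x 0 j) * _]mulrC; ring.
Qed.

Let partial_second i j : partial j (partial i (g \o clamp)) = second i j.
Proof.
rewrite (partial_clamp (@dg i)); apply/funext => x; rewrite /partial.
by case: (is_derive_second i j x).
Qed.

Lemma clamped_class_C2 : class_C 2 (g \o clamp).
Proof.
have comp f : continuous f -> continuous (f \o clamp).
  by move=> cf x; apply: continuous_comp; [exact: clamp_continuous|exact: cf].
split; first exact: comp.
move=> i; split; first by move=> x; case: (is_derive_clamp x (@dg i)).
split.
  rewrite (partial_clamp (@dg i)); apply: continuous_mul.
    exact: comp (@cdg i).
  exact: coord_comp_continuous (derive_continuous dt1).
move=> j; split.
  rewrite (partial_clamp (@dg i)) => x.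
  by case: (is_derive_second i j x).
split=> //; rewrite partial_second.
have ct1 := derive_continuous dt1.
apply: continuous_add; apply: continuous_mul.
- apply: continuous_mul; first exact: comp (@cddg i j).
  exact: coord_comp_continuous ct1.
- exact: coord_comp_continuous ct1.
- exact: comp (@cdg i).
- case: (i == j); first exact: coord_comp_continuous ct2.
  exact: cst_continuous.
Qed.

(** The derivatives of [g] are only evaluated in the compact box that contains
    the image of [clamp]. *)
Lemma clamped_bounded : exists M : R, forall x,
  [/\ `|(g \o clamp) x| <= M, forall i, `|partial i (g \o clamp) x| <= M &
      forall i j, `|partial j (partial i (g \o clamp)) x| <= M].
Proof.
have [M0 H0] := continuous_bounded_box C cg.
have /choice [M1 H1] := fun i => continuous_bounded_box C (@cdg i).
have /choice [M2 H2] : forall ij : 'I_m * 'I_m, exists M : R, forall x,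
    (forall i, `|x 0 i| <= C) -> `|partial ij.2 (partial ij.1 g) x| <= M.
  by move=> ij; exact: continuous_bounded_box (@cddg ij.1 ij.2).
pose S := `|M0| + \sum_i `|M1 i| + \sum_ij `|M2 ij|.
have S1 i : `|M1 i| <= \sum_i `|M1 i|.
  by rewrite (bigD1 i)//= lerDl sumr_ge0.
have S2 ij : `|M2 ij| <= \sum_ij `|M2 ij|.
  by rewrite (bigD1 ij)//= lerDl sumr_ge0.
have p1 : 0 <= \sum_i `|M1 i| by exact: sumr_ge0.
have p2 : 0 <= \sum_ij `|M2 ij| by exact: sumr_ge0.
have p0 := normr_ge0 M0.
have S0 : 0 <= S by rewrite /S; lra.
have b0 x : `|g (clamp x)| <= S.
  have := H0 _ (clamp_bound x); have := ler_norm M0; rewrite /S; lra.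
have b1 i x : `|partial i g (clamp x)| <= S.
  have := H1 i _ (clamp_bound x); have := ler_norm (M1 i); have := S1 i.
  rewrite /S; lra.
have b2 i j x : `|partial j (partial i g) (clamp x)| <= S.
  have := H2 (i, j) _ (clamp_bound x); have := ler_norm (M2 (i, j)).
  have := S2 (i, j); rewrite /S /=; lra.
have C0 : 0 <= C by case: (tC 0) => + _ _; exact: le_trans.
have q1 : 0 <= S * C by rewrite mulr_ge0.
have q2 : 0 <= S * C * C by rewrite mulr_ge0.
exists (S + S * C + S * C * C) => x; split.
- by have := b0 x; rewrite /=; lra.
- move=> i; rewrite (partial_clamp (@dg i)) normrM.
  have : `|partial i g (clamp x)| * `|t1 (x 0 i)| <= S * C.
    by apply: ler_pM => //; case: (tC (x 0 i)).
  lra.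
- move=> i j; rewrite partial_second /second.
  apply: le_trans (ler_normD _ _) _; rewrite !normrM.
  have : `|partial j (partial i g) (clamp x)| * `|t1 (x 0 j)| * `|t1 (x 0 i)|
      <= S * C * C.
    apply: ler_pM => //.
      by apply: ler_pM => //; case: (tC (x 0 j)).
    by case: (tC (x 0 i)).
  have : `|partial i g (clamp x)| * `|if i == j then t2 (x 0 i) else 0| <= S * C.
    apply: ler_pM => //; case: ifP => _; last by rewrite normr0.
    by case: (tC (x 0 i)).
  lra.
Qed.

End ClampedFunction.

Lemma partial_multi_bounded f (M : R) (a : 'I_m -> nat) x :
  (\sum_i a i <= 2)%N -> `|f x| <= M -> (forall i, `|partial i f x| <= M) ->
  (forall i j, `|partial j (partial i f) x| <= M) ->
  `|partial_multi a f x| <= M.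
Proof.
move=> a2 b0 b1 b2.
pose l := flatten [seq nseq (a i) i | i <- enum 'I_m].
have -> : partial_multi a f = foldr partial f l.
  rewrite /partial_multi /l; elim: (enum 'I_m) => //= i s ->.
  by rewrite foldr_cat; elim: (a i) => //= n ->.
have : (size l <= 2)%N.
  rewrite /l size_flatten /shape -map_comp sumnE big_map big_enum/=.
  by under eq_bigr do rewrite size_nseq.
case: l => [|i [|j [|]]] //=.
Qed.

(** The norm is an infimum over global extensions, which may well be unbounded;
    clamping the coordinates outside a box that contains [K] turns any
    extension into a bounded one. *)
Lemma Ck_norm_lty (K : set 'rV[R]_m) f : bounded_set K -> Ck_on 2 K f ->
  (Ck_norm 2 K f < +oo)%E.
Proof.
move=> [B [_ KB]] [g [Cg gf]].
have [t [t1 [t2 [dt ct2 tid tC]]]] := @smooth_clamp R (`|B| + 1) ltac:(by []).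
have dt0 (r : R) : is_derive r 1 t (t1 r) by case: (dt r).
have dt1 (r : R) : is_derive r 1 t1 (t2 r) by case: (dt r).
have [M HM] := clamped_bounded dt0 dt1 tC Cg.
have CG := clamped_class_C2 dt0 dt1 ct2 Cg.
set G := g \o _ in HM CG.
apply: (@le_lt_trans _ _ M%:E); last exact: ltry.
apply: ge_ereal_inf; exists (ereal_sup [set N | exists (a : 'I_m -> nat)
  (x : 'rV[R]_m), (\sum_i a i <= 2)%N /\ N = `|partial_multi a G x|%:E]).
  exists G => //; split; first exact: CG.
  move=> x Kx; rewrite -gf// /G /=; congr g; apply/rowP => i; rewrite mxE tid//.
  apply: le_trans (row_coord_le_norm x i) _; apply: KB => //.
  by rewrite (le_lt_trans (ler_norm B))// ltrDl.
apply: ge_ereal_sup => _ [a [x [a2 ->]]]; rewrite lee_fin.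
by have [b0 b1 b2] := HM x; exact: partial_multi_bounded.
Qed.

End ClampedExtension.

(** * Bounds on an almost optimal extension *)

Section OrderedPartials.
Context {R : realType} {m : nat}.
Implicit Types (f g : 'rV[R]_m -> R) (i j : 'I_m).

Let derive_along (a : 'I_m -> nat) f (s : seq 'I_m) :=
  foldr (fun i g => iter (a i) (partial i) g) f s.

Let derive_along_none a f s : (forall k, k \in s -> a k = 0%N) ->
  derive_along a f s = f.
Proof.
elim: s => //= k s ih a0; rewrite a0 ?mem_head//= ih// => l ls.
by rewrite a0// inE ls orbT.
Qed.

Let derive_along1 f i s : uniq s -> i \in s ->
  derive_along (fun k => (k == i : nat)) f s = partial i f.
Proof.
elim: s => //= k s ih /andP[ks us]; rewrite inE => /predU1P[ik|si].
  rewrite -ik eqxx /= derive_along_none// => l ls.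
  by case: eqP => // li; rewrite -ik -li ls in ks.
have ki : (k == i) = false by apply: contraNF ks => /eqP ->.
by rewrite ki /= ih.
Qed.

Let derive_along2 f i j s : sorted (fun k l : 'I_m => k < l)%N s ->
  (i <= j)%N -> i \in s -> j \in s ->
  derive_along (fun k => (k == i) + (k == j))%N f s = partial i (partial j f).
Proof.
have tr : transitive (fun k l : 'I_m => k < l)%N by move=> ? ? ?; exact: ltn_trans.
elim: s => //= k s ih ks ij.
have us : uniq (k :: s) by apply: (sorted_uniq tr _ (s := k :: s)) => // l; exact: ltnn.
have {}ih := ih (path_sorted ks).
have kl l : l \in s -> (k < l)%N.
  by move: ks; rewrite path_sortedE// => /andP[/allP + _]; exact.
rewrite !inE => /predU1P[ik|si] /predU1P[jk|sj].
- rewrite -ik jk -ik eqxx /= derive_along_none// => l ls.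
  have /ltn_eqF := kl _ ls; rewrite -ik eq_sym => h.
  by rewrite -[l == i]val_eqE h.
- have jkF : (k == j) = false by rewrite -val_eqE ltn_eqF// kl.
  rewrite -ik eqxx ik jkF /=; congr (partial _ _).
  rewrite -(@derive_along1 f j s) //; last by case/andP: us.
  rewrite /derive_along; elim: {+}s (kl) => //= l s' ih' kls'.
  rewrite ih'; last by move=> l' h; apply: kls'; rewrite inE h orbT.
  have -> : (l == k) = false by rewrite -val_eqE gtn_eqF// kls'// mem_head.
  by [].
- by have := kl _ si; rewrite -jk ltnNge ij.
- have -> : (k == i) = false by rewrite -val_eqE ltn_eqF// kl.
  have -> : (k == j) = false by rewrite -val_eqE ltn_eqF// kl.
  by rewrite /= ih.
Qed.

Lemma partial_multi0 f : partial_multi (fun=> 0%N) f = f.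
Proof. exact: derive_along_none. Qed.

Lemma partial_multi1 f i : partial_multi (fun k => (k == i : nat)) f = partial i f.
Proof. by apply: derive_along1; rewrite ?enum_uniq ?mem_enum. Qed.

(** Multi-index derivatives apply the partial derivatives from the last index
    to the first, so the pairs with [i <= j] are the ones they reach. *)
Lemma partial_multi2 f i j : (i <= j)%N ->
  partial_multi (fun k => (k == i) + (k == j))%N f = partial i (partial j f).
Proof.
move=> ij; apply: derive_along2; rewrite ?mem_enum//.
by have := iota_ltn_sorted 0 m; rewrite -val_enum_ord sorted_map.
Qed.

Lemma sum_nat_eq1 i : (\sum_k (k == i) = 1)%N.
Proof. by rewrite (bigD1 i)//= eqxx big1// => k /negbTE ->. Qed.

Definition C2_bounded (N : R) g := class_C 2 g /\
  forall (a : 'I_m -> nat) x, (\sum_i a i <= 2)%N -> `|partial_multi a g x| <= N.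

(** The infimum in the norm need not be attained; adding 1 makes room for an
    extension, and the absolute value makes the bound visibly positive. *)
Lemma Ck_norm_extension (K : set 'rV[R]_m) f : (Ck_norm 2 K f < +oo)%E ->
  exists2 g, C2_bounded (`|fine (Ck_norm 2 K f)| + 1) g &
    forall x, K x -> g x = f x.
Proof.
move=> Noo; set N := `|fine _| + 1.
have : (Ck_norm 2 K f < N%:E)%E.
  rewrite /N; case: (Ck_norm 2 K f) Noo => [r _| |] //=.
    by rewrite lte_fin (le_lt_trans (ler_norm r))// ltrDl.
  by rewrite ltNyr.
move=> /ereal_inf_lt [_ [g [Cg gf] <-] gN]; exists g => //; split=> // a x a2.
rewrite -lee_fin; apply: le_trans (ltW gN); apply: ereal_sup_ubound.
by exists a, x.
Qed.

Section Bounds.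
Variables (N : R) (g : 'rV[R]_m -> R).
Hypothesis gN : C2_bounded N g.

Lemma C2_bounded_continuous : continuous g.
Proof. by case: gN => -[]. Qed.

Lemma C2_bounded_partial_continuous i : continuous (partial i g).
Proof. by case: gN => -[_ /(_ i) [_ []]]. Qed.

Lemma C2_bounded_le x : `|g x| <= N.
Proof.
case: gN => _ /(_ (fun=> 0%N) x); rewrite partial_multi0; apply.
by rewrite big1.
Qed.

Lemma C2_bounded_partial_le i x : `|partial i g x| <= N.
Proof.
case: gN => _ /(_ (fun k => (k == i : nat)) x); rewrite partial_multi1; apply.
by rewrite sum_nat_eq1.
Qed.

Lemma C2_bounded_ge0 : 0 <= N.
Proof. exact: le_trans (normr_ge0 _) (C2_bounded_le 0). Qed.

Lemma C2_bounded_lipschitz x w : `|g (x + w) - g x| <= N * l1norm w.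
Proof.
apply: row_lipschitz => [|i]; first exact: C2_bounded_ge0.
split; first by case: gN => -[_ /(_ i) []].
exact: C2_bounded_partial_le.
Qed.

Lemma C2_bounded_taylor x w :
  `|g (x + w) - g x - \sum_j w 0 j * partial j g x| <= N * l1norm w ^+ 2.
Proof.
apply: row_taylor => [|j y|i j ij]; first exact: C2_bounded_ge0.
  by case: gN => -[_ /(_ j) []].
split; first by case: gN => -[_ /(_ j) [_ [_ /(_ i) []]]].
move=> y; case: gN => _ /(_ (fun k => (k == i) + (k == j))%N y).
by rewrite partial_multi2//; apply; rewrite big_split/= !sum_nat_eq1.
Qed.

End Bounds.

End OrderedPartials.

(** * Functions with a uniform quadratic first-order remainder *)

Section QuadraticRemainder.
Variables (R : realType) (h D : R -> R) (K : R).
Hypothesis hD : forall s t, s \in `[0, 1] -> t \in `[0, 1] ->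
  `|h t - h s - (t - s) * D s| <= K * (t - s) ^+ 2.

Lemma quadratic_remainder_derivative : derivative_on01 h D.
Proof.
move=> t t01; apply/cvgrPdist_le => e e0.
have K1 : 0 < `|K| + 1 by rewrite ltr_wpDl.
have neq : \forall s \near within `[0, 1] t^', s != t.
  exact: (cvg_within _ (nbhs_dnbhs_neq t)).
have close : \forall s \near within `[0, 1] t^', `|t - s| < e / (`|K| + 1).
  apply: cvg_within; apply: nbhs_dnbhs; apply/nbhs_ballP.
  by exists (e / (`|K| + 1)) => //=; exact: divr_gt0.
have mem : \forall s \near within `[0, 1] t^', s \in `[0, 1] by exact: withinT.
near=> s.
have s01 : s \in `[0, 1] by near: s.
have st : s != t by near: s.
have ste : `|t - s| < e / (`|K| + 1) by near: s.
have d0 : s - t != 0 by rewrite subr_eq0.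
rewrite distrC -[D t](mulfK d0) -mulrBl normrM normfV [D t * _]mulrC.
rewrite ler_pdivrMr ?normr_gt0//; apply: le_trans (hD t01 s01) _.
rewrite -[(s - t) ^+ 2]ger0_norm ?sqr_ge0// normrX expr2 mulrA ler_wpM2r//.
apply: le_trans (_ : (`|K| + 1) * `|s - t| <= _).
  by rewrite ler_wpM2r// (le_trans (ler_norm K))// lerDl.
by rewrite mulrC -ler_pdivlMr// distrC ltW.
Unshelve. all: by end_near. Qed.

(** The expansion at [s] evaluated at [t] and the expansion at [t] evaluated at
    [s] have opposite increments: their sum leaves only the derivatives. *)
Lemma quadratic_remainder_lipschitz s t : s \in `[0, 1] -> t \in `[0, 1] ->
  `|D t - D s| <= 2 * K * `|t - s|.
Proof.
move=> s01 t01; have [->|ts] := eqVneq t s; first by rewrite !subrr normr0 mulr0.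
have ts0 : 0 < `|t - s| by rewrite normr_gt0 subr_eq0.
have E : 2 * K * `|t - s| * `|t - s| = 2 * K * (t - s) ^+ 2.
  by rewrite -mulrA -normrM -[(t - s) * (t - s)]expr2 ger0_norm ?sqr_ge0.
rewrite -(ler_pM2r ts0) E -normrM.
have := hD s01 t01; have := hD t01 s01.
rewrite !ler_norml => /andP[h1 h2] /andP[h3 h4]; apply/andP; split; nra.
Qed.

(** Average the expansions at [t] evaluated at 0 and at 1 with weights [1 - t]
    and [t]: the first-order terms cancel, and [(1 - t) * t ^+ 2 +
    t * (1 - t) ^+ 2 = t * (1 - t)]. *)
Lemma quadratic_remainder_chord t : t \in `[0, 1] ->
  `|(1 - t) * h 0 + t * h 1 - h t| <= K * (t * (1 - t)).
Proof.
move=> t01.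
have e0 : (0 : R) \in `[0, 1] by rewrite in_itv/= lexx ler01.
have e1 : (1 : R) \in `[0, 1] by rewrite in_itv/= lexx ler01.
have /andP[t0 t1] : (0 <= t <= 1) by move: t01; rewrite in_itv.
have := hD t01 e0; have := hD t01 e1.
rewrite !ler_norml => /andP[h1 h2] /andP[h3 h4].
have t1' : 0 <= 1 - t by rewrite subr_ge0.
have a1 := ler_wpM2l t0 h1; have a2 := ler_wpM2l t0 h2.
have a3 := ler_wpM2l t1' h3; have a4 := ler_wpM2l t1' h4.
by apply/andP; split; lra.
Qed.

End QuadraticRemainder.

(** * Measurability of vector-valued maps *)

Section MeasurableRow.
Context {R : realType} {m : nat} dT (T : measurableType dT).
Variable f : T -> 'rV[R]_m.
Hypothesis mf : forall i, measurable_fun setT (fun x => f x 0 i).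

(** Every open set is a countable union of half-open grid cubes. *)
Lemma measurable_preimage_open (U : set 'rV[R]_m) : open U ->
  measurable (f @^-1` U).
Proof.
move=> oU.
pose cube (nq : nat * {ffun 'I_m -> int}) : set 'rV[R]_m :=
  [set y | forall i, (nq.2 i)%:~R <= nq.1.+1%:R * y 0 i < (nq.2 i + 1)%:~R].
pose F nq : set T := f @^-1` cube nq `&` [set _ | cube nq `<=` U].
have -> : f @^-1` U = \bigcup_nq F nq.
  apply/seteqP; split => [x Ux|x [nq _ [xnq]]]; last exact.
  have /nbhs_ballP [e /= e0 eU] : nbhs (f x) U.
    by move: oU; rewrite openE => /(_ _ Ux).
  pose n := Num.Def.archi_bound (e^-1).
  have en : n.+1%:R^-1 < e.
    rewrite invf_plt ?posrE// (lt_le_trans (archi_boundP _))//.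
      by rewrite invr_ge0 ltW.
    by rewrite ler_nat.
  pose q : {ffun 'I_m -> int} := [ffun i => Num.floor (n.+1%:R * f x 0 i)].
  have xq : cube (n, q) (f x) by move=> i; rewrite /= ffunE; exact: floor_itv.
  exists (n, q) => //; split=> // y yq; apply: eU; split=> // i j.
  rewrite ord1 -ball_normE /ball_/=; apply: lt_trans en.
  rewrite -[_^-1]mul1r ltr_pdivlMr// -[X in _ * X]ger0_norm// -normrM mulrC.
  have := xq j; have := yq j; rewrite /= intrD => /andP[h1 h2] /andP[h3 h4].
  by rewrite mulrBr ltr_norml; apply/andP; split; lra.
apply: countable_bigcupT_measurable => [|nq]; first exact: countableP.
have mcube : measurable (f @^-1` cube nq).
  have -> : f @^-1` cube nq = \bigcap_(i in [set: 'I_m])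
      ((fun x => f x 0 i) @^-1`
        [set r | (nq.2 i)%:~R <= nq.1.+1%:R * r < (nq.2 i + 1)%:~R]).
    by apply/seteqP; split => x h i; [move=> _; exact: h|exact: h].
  apply: fin_bigcap_measurable => [|i _]; first exact: finite_finset.
  rewrite (_ : [set r | _] =
    `[(nq.2 i)%:~R / nq.1.+1%:R, (nq.2 i + 1)%:~R / nq.1.+1%:R[%classic).
    by rewrite -[X in measurable X]setTI; apply: mf.
  apply/seteqP; split => r /=; rewrite in_itv/= ler_pdivrMr// ltr_pdivlMr//.
    by rewrite mulrC.
  by rewrite mulrC.
have [sub|nsub] := pselect (cube nq `<=` U).
  rewrite (_ : F nq = f @^-1` cube nq)//.
  by apply/seteqP; split => x // [].
rewrite (_ : F nq = set0)//.
by apply/seteqP; split => x // [].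
Qed.

Lemma measurable_continuous_comp (g : 'rV[R]_m -> R) : continuous g ->
  measurable_fun setT (g \o f).
Proof.
move=> cg; apply: (measurability _ (RGenOpens.measurableE R)).
move=> _ [_ [a [b ->] <-]]; rewrite setTI comp_preimage.
apply: measurable_preimage_open; apply: open_comp; last exact: interval_open.
by move=> x _; exact: cg.
Qed.

End MeasurableRow.

Section Borel.
Context {R : realType} {d : nat}.
Notation V := (borel_rV R d).

Lemma measurable_fun_borel_rV dT (T : measurableType dT) (f : T -> V) :
  (forall i, measurable_fun setT (fun x => (f x : 'rV[R]_d) 0 i)) ->
  measurable_fun setT f.
Proof.
move=> mf; apply: (@measurability _ _ _ V _ _ (@open 'rV[R]_d)) => //.
by move=> _ [U oU <-]; rewrite setTI; exact: (measurable_preimage_open mf).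
Qed.

Lemma measurable_coord i : measurable_fun setT (fun v : V => (v : 'rV[R]_d) 0 i).
Proof.
apply: (measurability _ (RGenOpens.measurableE R)).
move=> _ [_ [a [b ->] <-]]; rewrite setTI; apply: sub_sigma_algebra.
apply: (open_comp (f := fun v : 'rV[R]_d => v 0 i)); last exact: interval_open.
by move=> x _; exact: coord_continuous.
Qed.

Lemma closed_measurable_borel_rV (A : set 'rV[R]_d) : closed A ->
  measurable (A : set V).
Proof.
move=> cA; rewrite -[A]setCK; apply: measurableC; apply: sub_sigma_algebra.
exact: closed_openC.
Qed.

End Borel.

(** * Costs along geodesics in Lagrangian coordinates *)

Section Lagrangian.
Context {R : realType} {d : nat}.
Notation V := (borel_rV R d).
Notation W := ((V * V) * (V * V))%type.

Definition position (t : R) (z : W) : 'rV[R]_(d + d) :=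
  row_mx (interp t z.1) (interp t z.2).

Definition velocity (z : W) : 'rV[R]_(d + d) :=
  row_mx ((z.1.2 : 'rV[R]_d) - z.1.1) ((z.2.2 : 'rV[R]_d) - z.2.1).

(** Its integral against an optimal plan is the squared Wasserstein
    distance. *)
Definition sqr_displacement (z : V * V) : R := enorm ((z.2 : 'rV[R]_d) - z.1) ^+ 2.

Lemma sqr_displacementE z :
  sqr_displacement z = \sum_i ((z.2 : 'rV[R]_d) 0 i - (z.1 : 'rV[R]_d) 0 i) ^+ 2.
Proof.
rewrite /sqr_displacement /enorm sqr_sqrtr.
  by apply: eq_bigr => i _; rewrite !mxE.
by apply: sumr_ge0 => i _; exact: sqr_ge0.
Qed.

Lemma sqr_displacement_ge0 z : 0 <= sqr_displacement z.
Proof. exact: sqr_ge0. Qed.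

Lemma positionB (s t : R) z : position t z = position s z + (t - s) *: velocity z.
Proof.
rewrite /position /velocity scale_row_mx add_row_mx; congr row_mx;
  by apply/rowP => i; rewrite !mxE; ring.
Qed.

Lemma sum_sqr_velocity z : \sum_j velocity z 0 j ^+ 2 =
  sqr_displacement z.1 + sqr_displacement z.2.
Proof.
rewrite big_split_ord !sqr_displacementE /=; congr (_ + _);
  by apply: eq_bigr => i _; rewrite ?row_mxEl ?row_mxEr !mxE.
Qed.

Lemma sqr_l1norm_velocity z : l1norm (velocity z) ^+ 2 <=
  (d + d)%:R ^+ 2 * (sqr_displacement z.1 + sqr_displacement z.2).
Proof. by rewrite -sum_sqr_velocity; exact: l1norm_sqr_le. Qed.

Let measurable_coord_comp dT (T : measurableType dT) (f : T -> V) i :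
  measurable_fun setT f -> measurable_fun setT (fun x => (f x : 'rV[R]_d) 0 i).
Proof. by move=> mf; exact: measurableT_comp (measurable_coord i) mf. Qed.

Lemma measurable_interp (t : R) : measurable_fun setT (@interp R d t).
Proof.
apply: measurable_fun_borel_rV => i.
rewrite (_ : (fun _ => _) = (fun z : V * V =>
    (1 - t) * (z.1 : 'rV[R]_d) 0 i + t * (z.2 : 'rV[R]_d) 0 i)).
  apply: measurable_funD; apply: measurable_funM => //;
    exact: measurable_coord_comp.
by apply/funext => z; rewrite !mxE.
Qed.

Lemma measurable_sqr_displacement : measurable_fun setT sqr_displacement.
Proof.
rewrite (_ : sqr_displacement = fun z => \sum_(i < d)
    ((z.2 : 'rV[R]_d) 0 i - (z.1 : 'rV[R]_d) 0 i) ^+ 2); last first.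
  by apply/funext => z; exact: sqr_displacementE.
apply: measurable_sum => i; apply: measurable_funX.
by apply: measurable_funB; exact: measurable_coord_comp.
Qed.

Lemma measurable_row_mx_coord dT (T : measurableType dT) (f1 f2 : T -> V) j :
  measurable_fun setT f1 -> measurable_fun setT f2 ->
  measurable_fun setT (fun x => row_mx (f1 x : 'rV[R]_d) (f2 x) 0 j).
Proof.
move=> m1 m2; case: (split_ordP j) => i ->.
  rewrite (_ : (fun _ => _) = (fun x => (f1 x : 'rV[R]_d) 0 i)).
    exact: measurable_coord_comp.
  by apply/funext => x; rewrite row_mxEl.
rewrite (_ : (fun _ => _) = (fun x => (f2 x : 'rV[R]_d) 0 i)).
  exact: measurable_coord_comp.
by apply/funext => x; rewrite row_mxEr.
Qed.

Lemma measurable_position_coord (t : R) j :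
  measurable_fun setT (fun z => position t z 0 j).
Proof.
by apply: measurable_row_mx_coord;
  apply: (measurableT_comp (measurable_interp t)).
Qed.

Lemma measurable_velocity_coord j :
  measurable_fun setT (fun z => velocity z 0 j).
Proof.
case: (split_ordP j) => i ->.
  rewrite (_ : (fun _ => _) = (fun z : W =>
      (z.1.2 : 'rV[R]_d) 0 i - (z.1.1 : 'rV[R]_d) 0 i)).
    apply: measurable_funB; apply: measurable_coord_comp;
      by [exact: measurableT_comp measurable_snd measurable_fst|
          exact: measurableT_comp measurable_fst measurable_fst].
  by apply/funext => z; rewrite row_mxEl !mxE.
rewrite (_ : (fun _ => _) = (fun z : W =>
    (z.2.2 : 'rV[R]_d) 0 i - (z.2.1 : 'rV[R]_d) 0 i)).
  apply: measurable_funB; apply: measurable_coord_comp;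
    by [exact: measurableT_comp measurable_snd measurable_snd|
        exact: measurableT_comp measurable_fst measurable_snd].
by apply/funext => z; rewrite row_mxEr !mxE.
Qed.

Section Cost.
Variables (N : R) (g : 'rV[R]_(d + d) -> R).
Hypothesis gN : C2_bounded N g.

Definition lagrangian_cost (t : R) (z : W) : R := g (position t z).

(** The time derivative of [lagrangian_cost] at [s], by the chain rule. *)
Definition cost_rate (s : R) (z : W) : R :=
  \sum_j velocity z 0 j * partial j g (position s z).

Let N0 : 0 <= N := C2_bounded_ge0 gN.

Lemma bounded_measurable_cost :
  bounded_measurable (fun z : V * V => g (row_mx z.1 z.2)).
Proof.
split; last by exists N => z; exact: C2_bounded_le.
apply: (measurable_continuous_comp (f := fun z : V * V => row_mx (z.1 : 'rV[R]_d) z.2)).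
  by move=> j; exact: measurable_row_mx_coord.
exact: C2_bounded_continuous gN.
Qed.

Lemma measurable_cost_rate s : measurable_fun setT (cost_rate s).
Proof.
apply: measurable_sum => j; apply: measurable_funM.
  exact: measurable_velocity_coord.
apply: (measurable_continuous_comp (measurable_position_coord s)).
exact: (@C2_bounded_partial_continuous _ _ _ _ gN j).
Qed.

Lemma cost_rate_le s z : `|cost_rate s z| <= N * (1 + (d + d)%:R ^+ 2) *
  (1 + (sqr_displacement z.1 + sqr_displacement z.2)).
Proof.
have l0 := l1norm_ge0 (velocity z).
apply: le_trans (_ : N * l1norm (velocity z) <= _).
  apply: le_trans (ler_norm_sum _ _ _) _; rewrite mulr_sumr; apply: ler_sum => j _.
  by rewrite normrM mulrC ler_wpM2r//; exact: C2_bounded_partial_le.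
rewrite -mulrA ler_wpM2l//; have := sqr_l1norm_velocity z.
set q := sqr_displacement _ + _; set M := (d + d)%:R ^+ 2 => H.
have q0 : 0 <= q by rewrite addr_ge0 ?sqr_displacement_ge0.
have M0 : 0 <= M by exact: sqr_ge0.
have Mq := mulr_ge0 M0 q0; have := sqr_ge0 (l1norm (velocity z) - 1); lra.
Qed.

Lemma l1norm_scale (r : R) m (w : 'rV[R]_m) : l1norm (r *: w) = `|r| * l1norm w.
Proof.
by rewrite /l1norm mulr_sumr; apply: eq_bigr => i _; rewrite mxE normrM.
Qed.

Lemma lagrangian_cost_taylor (s t : R) z :
  `|lagrangian_cost t z - lagrangian_cost s z - (t - s) * cost_rate s z| <=
  N * (d + d)%:R ^+ 2 * (t - s) ^+ 2 * (sqr_displacement z.1 + sqr_displacement z.2).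
Proof.
rewrite /lagrangian_cost (positionB s t).
have := C2_bounded_taylor gN (position s z) ((t - s) *: velocity z).
have -> : \sum_j ((t - s) *: velocity z) 0 j * partial j g (position s z) =
    (t - s) * cost_rate s z.
  by rewrite mulr_sumr; apply: eq_bigr => j _; rewrite mxE mulrA.
move=> /le_trans; apply; rewrite l1norm_scale exprMn -normrX ger0_norm ?sqr_ge0//.
set q := sqr_displacement _ + _.
rewrite [leRHS](_ : _ = N * ((t - s) ^+ 2 * ((d + d)%:R ^+ 2 * q))); last by ring.
rewrite ler_wpM2l// ler_wpM2l ?sqr_ge0//.
exact: sqr_l1norm_velocity.
Qed.

Lemma lagrangian_cost_lipschitz (s t : R) z :
  (lagrangian_cost t z - lagrangian_cost s z) ^+ 2 <=
  N ^+ 2 * (d + d)%:R ^+ 2 * (t - s) ^+ 2 *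
  (sqr_displacement z.1 + sqr_displacement z.2).
Proof.
rewrite /lagrangian_cost (positionB s t).
have h := C2_bounded_lipschitz gN (position s z) ((t - s) *: velocity z).
rewrite -[leLHS]ger0_norm ?sqr_ge0// normrX.
apply: le_trans (_ : (N * l1norm ((t - s) *: velocity z)) ^+ 2 <= _).
  by rewrite ler_sqr ?nnegrE// mulr_ge0 ?l1norm_ge0.
rewrite exprMn l1norm_scale exprMn -normrX ger0_norm ?sqr_ge0//.
set q := sqr_displacement _ + _.
rewrite [leRHS](_ : _ = N ^+ 2 * ((t - s) ^+ 2 * ((d + d)%:R ^+ 2 * q)));
  last by ring.
rewrite ler_wpM2l ?sqr_ge0// ler_wpM2l ?sqr_ge0//.
exact: sqr_l1norm_velocity.
Qed.

(** Pulling potentials back along the geodesics turns the moving marginals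
    [mu1 t], [mu2 t] with a fixed cost into fixed marginals [gam1], [gam2] with
    a moving cost.  The dual value is unchanged, as the potentials at time [t]
    depend only on the position at time [t]. *)
Lemma EOT_lagrangian (X1 X2 : set 'rV[R]_d) (c : 'rV[R]_(d + d) -> R)
    (mu1 mu2 : probability V R) (gam1 gam2 : probability (V * V)%type R) (t : R) :
  compact X1 -> compact X2 -> (forall z, prod_set X1 X2 z -> g z = c z) ->
  supported_in X1 mu1 -> supported_in X2 mu2 ->
  (forall A : set V, measurable A -> mu1 A = pushforward gam1 (interp t) A) ->
  (forall A : set V, measurable A -> mu2 A = pushforward gam2 (interp t) A) ->
  exists a b, schroedinger_solution gam1 gam2 (lagrangian_cost t) a b /\
    EOT X1 X2 c mu1 mu2 = dual_value gam1 gam2 a b.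
Proof.
move=> cX1 cX2 gc sX1 sX2 law1 law2.
have mX (X : set 'rV[R]_d) : compact X -> measurable (X : set V).
  by move=> cX; apply: closed_measurable_borel_rV; exact: compact_closed.
have bcost := bounded_measurable_cost.
have [a [b sol]] := schroedinger_solution_exists mu1 mu2 bcost.
have mi := measurable_interp t.
have [la lb s1 s2] := sol.
exists (a \o interp t), (b \o interp t); split; last first.
  rewrite (EOT_potentials (mX _ cX1) (mX _ cX2) gc bcost sX1 sX2 sol).
  have [_ bla] := la; have [_ blb] := lb.
  rewrite /dual_value (Rintegral_law mi law1 bla).
  by rewrite (Rintegral_law mi law2 blb).
have bK := bounded_measurable_expR (bounded_measurableN bcost).
split; [exact: log_bounded_comp mi la|exact: log_bounded_comp mi lb| |].
- move=> x; rewrite -(s1 (interp t x)) /=; congr (_ * _).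
  rewrite (Rintegral_law mi law2)//.
  apply: bounded_measurableM; last exact: log_bounded_bounded.
  exact: (bounded_measurable_slice _ bK).
- move=> y; rewrite -(s2 (interp t y)) /=; congr (_ * _).
  rewrite (Rintegral_law mi law1)//.
  apply: bounded_measurableM; last exact: log_bounded_bounded.
  exact: (bounded_measurable_slice2 _ bK).
Qed.

End Cost.

(** The plan gives full mass to the product of compact sets, where displacements
    are bounded. *)
Lemma sqr_displacement_integrable (X : set 'rV[R]_d) (mu nu : probability V R)
    (gam : probability (V * V)%type R) :
  compact X -> supported_in X mu -> supported_in X nu -> coupling mu nu gam ->
  gam.-integrable setT (EFin \o sqr_displacement).
Proof.
move=> cX sXmu sXnu cgam.
have mX : measurable (X : set V).
  by apply: closed_measurable_borel_rV; exact: compact_closed.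
have out := coupling_null_complement mX mX sXmu sXnu cgam.
pose N : set (V * V) := ~` (X `*` X).
have mXX : measurable (X `*` X : set (V * V)) by exact: measurableX.
have mN : measurable N by exact: measurableC.
have mq := measurable_sqr_displacement.
apply/(negligible_integrable mN measurableT _ out); first exact/measurable_EFinP.
rewrite /N setDE setCK setTI; apply: measurable_bounded_integrable => //.
- by rewrite ltey_eq fin_num_measure.
- exact: measurable_funTS.
have [B [_ XB]] := compact_bounded cX.
pose M := `|B| + 1.
have XM x i : X x -> `|x 0 i| <= M.
  move=> Xx; apply: le_trans (row_coord_le_norm x i) _; apply: XB => //.
  by rewrite (le_lt_trans (ler_norm B))// ltrDl.
exists (\sum_(i < d) (M + M) ^+ 2); split; first exact: num_real.
move=> r Mr z [z1 z2]; apply: le_trans (ltW Mr).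
rewrite ger0_norm ?sqr_displacement_ge0// sqr_displacementE.
apply: ler_sum => i _; rewrite -[leLHS]ger0_norm ?sqr_ge0// normrX.
have M0 : 0 <= M by rewrite /M addr_ge0.
rewrite ler_sqr ?nnegrE ?addr_ge0//.
by apply: le_trans (ler_normB _ _) _; apply: lerD; exact: XM.
Qed.

(** An optimal plan attains the infimum that defines [W2]. *)
Lemma sqr_W2 (mu nu : probability V R) (gam : probability (V * V)%type R) :
  optimal_plan mu nu gam -> W2 mu nu ^+ 2 = \int[gam]_z sqr_displacement z.
Proof.
move=> [cgam opt].
have E : ereal_inf [set quad_cost g | g in coupling mu nu] = quad_cost gam.
  apply/eqP; rewrite eq_le; apply/andP; split.
    by apply: ereal_inf_lbound; exists gam.
  by apply: le_ereal_inf_tmp => _ [g' cg' <-]; exact: opt.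
rewrite /W2 E sqr_sqrtr//; apply: fine_ge0; apply: integral_ge0 => z _.
by rewrite lee_fin; exact: sqr_ge0.
Qed.

(** Taylor's remainder of the cost, plus the second-order error in
    [expR (l - l')] for two costs bounded by [N]; [(d + d)%:R ^+ 2] compares the
    squares of the [l1norm] and the Euclidean norm. *)
Definition remainder_constant (N : R) : R :=
  N * (d + d)%:R ^+ 2 + expR (N + N) * (N ^+ 2 * (d + d)%:R ^+ 2).

Lemma remainder_constant_ge0 N : 0 <= N -> 0 <= remainder_constant N.
Proof.
by move=> N0; rewrite addr_ge0 ?mulr_ge0 ?expR_ge0 ?sqr_ge0.
Qed.

(** [D s] is the rate of the cost at time [s], averaged over the optimal entropic
    plan at that time: as the problem is stationary in the plan, the motion of
    the plan contributes to second order only. *)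
Lemma EOT_geodesic_remainder (N : R) (X1 X2 : set 'rV[R]_d)
    (c : 'rV[R]_(d + d) -> R) (mu1 mu2 : R -> probability V R) :
  (exists2 g, C2_bounded N g & forall z, prod_set X1 X2 z -> g z = c z) ->
  compact X1 -> compact X2 -> W2_geodesic X1 mu1 -> W2_geodesic X2 mu2 ->
  exists D : R -> R, forall s t : R, s \in `[0, 1] -> t \in `[0, 1] ->
    `|EOT X1 X2 c (mu1 t) (mu2 t) - EOT X1 X2 c (mu1 s) (mu2 s) - (t - s) * D s|
    <= remainder_constant N * W2pair (mu1 0) (mu2 0) (mu1 1) (mu2 1) ^+ 2 *
       (t - s) ^+ 2.
Proof.
move=> [g gN gc] cX1 cX2 [sX1 [gam1 [opt1 law1]]] [sX2 [gam2 [opt2 law2]]].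
have e0 : (0 : R) \in `[0, 1] by rewrite in_itv/= lexx ler01.
have e1 : (1 : R) \in `[0, 1] by rewrite in_itv/= lexx ler01.
have iq1 := sqr_displacement_integrable cX1 (sX1 _ e0) (sX1 _ e1) (proj1 opt1).
have iq2 := sqr_displacement_integrable cX2 (sX2 _ e0) (sX2 _ e1) (proj1 opt2).
have -> : W2pair (mu1 0) (mu2 0) (mu1 1) (mu2 1) ^+ 2 =
    \int[gam1]_z sqr_displacement z + \int[gam2]_z sqr_displacement z.
  rewrite /W2pair sqr_sqrtr ?addr_ge0 ?sqr_ge0//.
  by rewrite (sqr_W2 opt1) (sqr_W2 opt2).
have mcost t : bounded_measurable (lagrangian_cost g t).
  apply: (bounded_measurable_comp (f := fun z : V * V => g (row_mx z.1 z.2))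
    (phi := fun z : W => (interp t z.1, interp t z.2))).
    apply: measurable_fun_pair; first exact: measurableT_comp (measurable_interp t) _.
    exact: measurableT_comp (measurable_interp t) _.
  exact: bounded_measurable_cost gN.
have lag t (t01 : t \in `[0, 1]) := EOT_lagrangian gN cX1 cX2 gc
  (sX1 _ t01) (sX2 _ t01) (law1 _ t01) (law2 _ t01).
set K := _ * (_ + _).
suff /choice [D HD] : forall s, exists D : R, forall t,
    s \in `[0, 1] -> t \in `[0, 1] ->
    `|EOT X1 X2 c (mu1 t) (mu2 t) - EOT X1 X2 c (mu1 s) (mu2 s) - (t - s) * D|
    <= K * (t - s) ^+ 2.
  by exists D => s t; exact: HD.
move=> s; have [s01|s01] := boolP (s \in `[0, 1]); last by exists 0.
have [a [b [sol Es]]] := lag s s01.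
exists (\int[(gam1 \x gam2)%E]_z (gibbs_density (lagrangian_cost g s) a b z *
  cost_rate g s z)) => t _ t01.
have [a' [b' [sol' Et]]] := lag t t01.
rewrite Es Et /K mulrAC.
apply: (dual_value_expansion (mcost s) (mcost t) sol sol'
  (measurable_cost_rate gN s) iq1 iq2 (cost_rate_le gN s)).
- by move=> z; exact: C2_bounded_le gN _.
- by move=> z; exact: C2_bounded_le gN _.
- exact: lagrangian_cost_taylor.
- exact: lagrangian_cost_lipschitz.
Qed.

Lemma bounded_prod_set (X1 X2 : set 'rV[R]_d) : compact X1 -> compact X2 ->
  bounded_set (prod_set X1 X2).
Proof.
move=> /compact_bounded [B1 [_ XB1]] /compact_bounded [B2 [_ XB2]].
exists (Num.max B1 B2); split; first exact: num_real.
move=> M; rewrite gt_max => /andP[M1 M2] z [z1 z2].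
have M0 : 0 <= M by exact: le_trans (normr_ge0 _) (XB1 _ M1 _ z1).
suff : mx_norm z <= M by [].
rewrite mx_normrE; apply/bigmax_leP; split=> // -[i j] _ /=.
rewrite ord1 -[z]hsubmxK; case: (split_ordP j) => k ->.
  by rewrite row_mxEl; apply: le_trans (row_coord_le_norm _ k) (XB1 _ M1 _ z1).
by rewrite row_mxEr; apply: le_trans (row_coord_le_norm _ k) (XB2 _ M2 _ z2).
Qed.

End Lagrangian.

Theorem corollary1p2 (R : realType) (d : nat) :
  exists C : \bar R -> R, (forall M, 0 < C M) /\
  forall (X1 X2 : set 'rV[R]_d) (c : 'rV[R]_(d + d) -> R),
    compact X1 -> convex_set (X1 : set (convex_lmodType 'rV[R]_d)) ->
    compact X2 -> convex_set (X2 : set (convex_lmodType 'rV[R]_d)) ->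
    Ck_on 2 (prod_set X1 X2) c ->
    (forall mu1 mu2 : R -> probability (borel_rV R d) R,
       W2_geodesic X1 mu1 -> W2_geodesic X2 mu2 ->
       exists h' : R -> R,
         derivative_on01 (fun t => EOT X1 X2 c (mu1 t) (mu2 t)) h' /\
         forall s t : R, s \in `[0, 1] -> t \in `[0, 1] ->
           `|h' t - h' s| <= C (Ck_norm 2 (prod_set X1 X2) c) * `|t - s|
                             * W2pair (mu1 0) (mu2 0) (mu1 1) (mu2 1) ^+ 2) /\
    displacement_semiconvex X1 X2 (EOT X1 X2 c) /\
    displacement_semiconvex X1 X2 (fun nu1 nu2 => - EOT X1 X2 c nu1 nu2).
Proof.
pose N (M : \bar R) : R := `|fine M| + 1.
have N0 M : 0 <= N M by rewrite addr_ge0.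
exists (fun M => 2 * remainder_constant (d := d) (N M) + 1); split.
  by move=> M; rewrite ltr_wpDl// mulr_ge0// remainder_constant_ge0.
move=> X1 X2 c cX1 _ cX2 _ Cc.
set M := Ck_norm 2 _ c.
have Moo : (M < +oo)%E by apply: Ck_norm_lty => //; exact: bounded_prod_set.
have ext := Ck_norm_extension Moo.
have rem := fun mu1 mu2 => @EOT_geodesic_remainder _ _ _ _ _ _ mu1 mu2 ext cX1 cX2.
have lower (a b e r t w : R) : - (r * w * (t * (1 - t))) <= (1 - t) * a + t * b - e ->
    e <= (1 - t) * a + t * b - (- 2 * r) / 2 * t * (1 - t) * w.
  by lra.
have upper (a b e r t w : R) : (1 - t) * a + t * b - e <= r * w * (t * (1 - t)) ->
    - e <= (1 - t) * - a + t * - b - (- 2 * r) / 2 * t * (1 - t) * w.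
  by lra.
split; [|split].
- move=> mu1 mu2 geo1 geo2; have [h' H] := rem _ _ geo1 geo2.
  exists h'; split; first exact: quadratic_remainder_derivative H.
  move=> s t s01 t01.
  apply: le_trans (quadratic_remainder_lipschitz H s01 t01) _.
  rewrite -/M -/(N M); set W := W2pair _ _ _ _.
  rewrite [leLHS](_ : _ = 2 * remainder_constant (d := d) (N M) * `|t - s| * W ^+ 2);
    last by ring.
  by rewrite ler_wpM2r ?sqr_ge0// ler_wpM2r// lerDl.
- exists (- 2 * remainder_constant (d := d) (N M)) => mu1 mu2 geo1 geo2 t t01.
  have [h' H] := rem _ _ geo1 geo2.
  have := quadratic_remainder_chord H t01.
  by rewrite ler_norml => /andP[/lower + _]; exact.
- exists (- 2 * remainder_constant (d := d) (N M)) => mu1 mu2 geo1 geo2 t t01.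
  have [h' H] := rem _ _ geo1 geo2.
  have := quadratic_remainder_chord H t01.
  by rewrite ler_norml => /andP[_ /upper]; exact.
Qed.
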